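(* Let $m,n\ge1$ be integers, let $J\in\mathbb{C}^{m\times m}$ satisfy $J=J^*=J^{-1}$, and let $H:[a,b]\to\mathbb{C}^{m\times m}$ have integrable entries with $H(x)\ge0$ for almost all $x\in[a,b]$. Let $$W(b,z)=\overset{b}{\overset{\curvearrowleft}{\underset{a}{\int}}}\mathrm{e}^{\frac{\mathrm{i}J}{z-t}H(t)\,dt}.$$ Let $B\in\mathbb{C}^{n\times n}$ with $\sigma(B)\cap[a,b]=\emptyset$, put $A(x)=(B-xI_n)^{-1}$, let $S(a)=S(a)^*\in\mathbb{C}^{n\times n}$ and $\Pi(a)\in\mathbb{C}^{n\times m}$ satisfy $A(a)S(a)-S(a)A(a)^*=\mathrm{i}\Pi(a)J\Pi(a)^*$, and let $\Pi(x),S(x)$ be the solutions on $[a,b]$, with these values at $a$, of $$\Pi_x=-\mathrm{i}A\Pi JH,\qquad S_x=\Pi JHJ^*\Pi^*-(AS+SA^* ).$$ Assume that $S(x)$ is invertible for every $x\in[a,b]$. Put $$w_0(x)=I_m-\mathrm{i}J\Pi(x)^*S(x)^{-1}A(x)^{-1}\Pi(x),\qquad \widetilde H(x)=w_0(x)^*H(x)w_0(x),\qquad \widetilde W(b,z)=\overset{b}{\overset{\curvearrowleft}{\underset{a}{\int}}}\mathrm{e}^{\frac{\mathrm{i}J}{z-t}\widetilde H(t)\,dt}.$$ If $\|W(b,z)\|$ is bounded in the upper half-plane $\mathbb{C}_+$ (respectively in the lower half-plane $\mathbb{C}_-$), then $\|\widetilde W(b,z)\|$ is bounded in $\mathbb{C}_+$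 (respectively in $\mathbb{C}_-$) as well.
   Context: Here $*$ is the conjugate transpose, $\sigma(B)$ is the spectrum of $B$, the subscript $x$ is $d/dx$, $\mathbb{C}_\pm=\{z\in\mathbb{C}:\pm\Im z>0\}$ are the open half-planes, and differential equations with integrable coefficients are understood for absolutely continuous functions, almost everywhere. Multiplicative integral: for integrable $H$ on $[a,b]$ and $z\notin[a,b]$, the multiplicative integral $\overset{x}{\overset{\curvearrowleft}{\underset{a}{\int}}}\mathrm{e}^{\frac{\mathrm{i}J}{z-t}H(t)dt}$ is the value at $x$ of the $m\times m$ fundamental solution of the system $w_x(x,z)=\mathrm{i}(z-x)^{-1}JH(x)w(x,z)$ $(a\le x\le b)$ normalised to equal $I_m$ at $x=a$ (equivalently, the limit of the ordered products of exponentials over partitions of $[a,x]$, with factors for larger $t$ standing to the left). *)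

(* Defs.v *)
From mathcomp Require Export all_boot all_order all_algebra.
From mathcomp Require Export sesquilinear spectral.
From mathcomp Require Export all_classical all_reals all_analysis.
From mathcomp Require Export complex.

Set Implicit Arguments.
Unset Strict Implicit.
Unset Printing Implicit Defensive.

Export Order.TTheory GRing.Theory Num.Theory.
Export numFieldNormedType.Exports.

Local Open Scope classical_set_scope.
Local Open Scope ring_scope.
Local Open Scope sesquilinear_scope.
Local Open Scope complex_scope.

Definition abs_continuous (R : realType) (a b : R) (f : R -> R) : Prop :=
  forall e : R, 0 < e -> exists2 d : R, 0 < d &
    forall (k : nat) (u v : 'I_k -> R),
      (forall i, [/\ a <= u i, u i <= v i & v i <= b]) ->
      trivIset setT (fun i => `]u i, v i[%classic) ->
      \sum_i (v i - u i) < d ->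
      \sum_i `|f (v i) - f (u i)| < e.

Definition mx_abs_continuous (R : realType) (a b : R) (p q : nat)
    (f : R -> 'M[R[i]]_(p, q)) : Prop :=
  forall i j, abs_continuous a b (fun t => complex.Re (f t i j)) /\
              abs_continuous a b (fun t => complex.Im (f t i j)).

Definition is_mx_derive (R : realType) (p q : nat)
    (f : R -> 'M[R[i]]_(p, q)) (x : R) (D : 'M[R[i]]_(p, q)) : Prop :=
  forall i j, is_derive x 1 (fun t => complex.Re (f t i j)) (complex.Re (D i j)) /\
              is_derive x 1 (fun t => complex.Im (f t i j)) (complex.Im (D i j)).

(* [f_x = g] on [a, b]; in a differential equation, [g] depends on [f]. *)
Definition ac_derive (R : realType) (a b : R) (p q : nat)
    (f g : R -> 'M[R[i]]_(p, q)) : Prop :=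
  mx_abs_continuous a b f /\
  {ae lebesgue_measure, forall x : R, x \in `[a, b] -> is_mx_derive f x (g x)}.

(* The completed measure makes this integrability of Lebesgue measurable,
   rather than only Borel measurable, functions. *)
Definition mx_integrable (R : realType) (a b : R) (p q : nat)
    (f : R -> 'M[R[i]]_(p, q)) : Prop :=
  forall i j,
    completed_lebesgue_measure.-integrable `[a, b]
      (fun t => (complex.Re (f t i j))%:E) /\
    completed_lebesgue_measure.-integrable `[a, b]
      (fun t => (complex.Im (f t i j))%:E).

(* In R[i], [0 <= c] means that [c] is real and nonnegative. *)
Definition psdmx (R : realType) (m : nat) (M : 'M[R[i]]_m) : Prop :=
  M \is hermsymmx /\ forall v : 'cV[R[i]]_m, 0 <= (v^t* *m M *m v) 0 0.

Definition is_fundamental_solution (R : realType) (m : nat)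
    (J : 'M[R[i]]_m) (H : R -> 'M[R[i]]_m) (a b : R) (z : R[i])
    (w : R -> 'M[R[i]]_m) : Prop :=
  w a = 1%:M /\
  ac_derive a b w (fun x => ('i / (z - x%:C)) *: (J *m H x *m w x)).

(* For H integrable on [a, b] and z outside [a, b] the fundamental solution
   exists and its values on [a, b] are unique (Caratheodory), so that the
   default value 0 of [xget] is irrelevant. *)
Definition multint (R : realType) (m : nat)
    (J : 'M[R[i]]_m) (H : R -> 'M[R[i]]_m) (a b : R) (z : R[i]) : 'M[R[i]]_m :=
  xget 0 [set M | exists2 w, is_fundamental_solution J H a b z w & M = w b].

(* Boundedness does not depend on the choice of the matrix norm; [mx_norm] is
   the maximum of the moduli of the entries. *)
Definition mx_bounded_on (R : realType) (m : nat) (D : set R[i])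
    (W : R[i] -> 'M[R[i]]_m) : Prop :=
  exists c : R, forall z, D z -> mx_norm (W z) <= c%:C.

Definition upper_half_plane (R : realType) : set R[i] :=
  [set z | 0 < complex.Im z].
Definition lower_half_plane (R : realType) : set R[i] :=
  [set z | complex.Im z < 0].
Arguments upper_half_plane R : clear implicits.
Arguments lower_half_plane R : clear implicits.

(* Main.v *)
(* Put Ga = iJPi^*, L = iJH, D = A^* and X = S^-1, so that AS - SD = Pi Ga on
   all of [a, b]. For l = 1/(z - x) the Darboux matrix
   w = 1 - Ga X (A - l)^-1 Pi satisfies w' = q w + l (L w - w L) with a gauge
   term q independent of l, and w0 is the case l = 0. Hence v = w0^-1 w
   intertwines the two systems:
   W~(b,z) = v(b,z) W(b,z) v(a,z)^-1. Here v(b,z) and v(a,z)^-1 are bounded away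
   from the spectrum of B and its complex conjugate, because
   (A - l)^-1 = (z - x)(z - B)^-1(B - x). Near these finitely many points, which
   stay away from [a, b], Gronwall's inequality bounds W~(b,z) directly.
   Gronwall's inequality for absolutely continuous functions rests on continuous
   induction along [a, b]: exceptional null sets are covered by open sets of
   small measure, and an integrable h is majorized by a nondecreasing function
   whose lower derivative is at least h at every point. *)
Require Import Defs.
From mathcomp Require Import lra ring measurable_realfun.

Set Implicit Arguments.
Unset Strict Implicit.
Unset Printing Implicit Defensive.

Local Open Scope classical_set_scope.
Local Open Scope ring_scope.
Local Open Scope sesquilinear_scope.
Local Open Scope complex_scope.

(** * Increments of absolutely continuous functions *)

(** The transfer runs from the transformed system back to the original one. If the transformed
    system has no fundamental solution at z, [multint] takes its default value 0, which is bounded.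
    Otherwise the inverse intertwiner w^-1 w0 maps the given solution to a fundamental solution of
    the original system, and uniqueness (Gronwall with initial difference 0) identifies its value at
    b with W(b,z). Darboux conjugation produces the generator w0^-1 L w0, while the transformed
    Hamiltonian is w0^* H w0. The two agree because w0 is J-unitary, and this rests on S = S^* on
    all of [a, b], which has to be propagated from a. No determinant has to be bounded from below:
    w^-1 is again of Darboux form, with the resolvent of D in place of that of A. This is how the
    conjugate of the spectrum of B comes in. *)

(** Applied at the supremum of the points where [P] holds, the step carries [P] from a point just
    left of it across to a point on its right. *)
Lemma continuous_induction (R : realType) (a b : R) (P : R -> Prop) :
  a <= b -> P a ->
  (forall c, a <= c -> c <= b -> exists2 d : R, 0 < d & forall x y,
     a <= x -> x <= c -> c <= y -> y <= b -> y - x < d -> P x -> P y) ->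
  P b.
Proof.
move=> leab Pa step.
pose A := [set x | [/\ a <= x, x <= b & P x]].
have Aa : A a by [].
have hsA : has_sup A by split; [exists a | exists b => x []].
have ac : a <= sup A by apply: ub_le_sup => //; exact: hsA.2.
have cb : sup A <= b by apply: ge_sup; [exists a | move=> x []].
have [d d0 stepc] := step _ ac cb.
have [x [ax xb Px] xc] : exists2 x, A x & sup A - d / 2 < x.
  by apply: sup_adherent => //; rewrite divr_gt0.
have xlec : x <= sup A by apply: ub_le_sup => //; exact: hsA.2.
(* [x] lies within d / 2 of the supremum and [y] overshoots it by at most d / 3, so y - x < d. *)
pose y := Num.min b (sup A + d / 3).
have yb : y <= b by rewrite ge_min lexx.
have cy : sup A <= y by rewrite le_min cb; lra.
have yd : y <= sup A + d / 3 by rewrite ge_min lexx orbT.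
have Py : P y by apply: (stepc x) => //; lra.
have ysup : y <= sup A.
  by apply: ub_le_sup; [exact: hsA.2 | split=> //; exact: le_trans ac cy].
have [bs|sb] := leP b (sup A + d / 3); first by move: Py; rewrite /y (min_idPl bs).
exfalso; move: ysup; rewrite /y (min_r (ltW sb)); lra.
Qed.

Lemma sum_len_le_measure (R : realType) (U : set R) (k : nat) (u v : 'I_k -> R) :
  measurable (U : set (measurableTypeR R)) ->
  (forall i, u i <= v i) -> (forall i, `]u i, v i[ `<=` U) ->
  trivIset setT (fun i => `]u i, v i[%classic) ->
  ((\sum_i (v i - u i))%:E <= lebesgue_measure U)%E.
Proof.
move=> mU uv subU triv.
rewrite (_ : (_%:E) = lebesgue_measure (\big[setU/set0]_(i < k) `]u i, v i[%classic)).
  apply: le_measure; rewrite ?inE //.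
    by apply: bigsetU_measurable => i _; exact: measurable_itv.
  by elim/big_ind: _ => // A B AU BU x [/AU|/BU].
rewrite measure_bigsetU_ord //.
rewrite -sumEFin; apply: eq_bigr => i _.
rewrite -[RHS]/(lebesgue_measure [set` `]u i, v i[]) lebesgue_measure_itv /= lte_fin -EFinB.
case: ltP => // vu; congr EFin; apply/eqP; rewrite subr_eq0 eq_le vu uv //.
Qed.

(** Off [N] the local inequality pays for the increment. Intervals crossed near a point of [N] lie
    in an open set whose measure is below the modulus of absolute continuity of [g] for [e], so
    together they cost less than [e]. *)
Lemma ac_increment_le (R : realType) (a b : R) (g F : R -> R) (N : set R) :
  a <= b -> abs_continuous a b g ->
  (forall x y, a <= x -> x <= y -> y <= b -> F x <= F y) ->
  lebesgue_measure.-negligible N ->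
  (forall c, a <= c -> c <= b -> ~ N c -> forall e : R, 0 < e ->
     exists2 d : R, 0 < d & forall x y,
     a <= x -> x <= c -> c <= y -> y <= b -> y - x < d ->
     g y - g x <= F y - F x + e * (y - x)) ->
  g b - g a <= F b - F a.
Proof.
move=> leab acg homF negN loc.
suff H (e : R) : 0 < e -> g b - g a <= F b - F a + e * (b - a) + e.
  apply/ler_addgt0Pr => e e0.
  have d0 : 0 < 1 + (b - a) by rewrite ltr_pwDl // subr_ge0.
  have := H (e / (1 + (b - a))) (divr_gt0 e0 d0).
  rewrite -addrA -[X in _ + (_ + X)]mulr1 -mulrDr [_ - _ + 1]addrC divfK ?gt_eqF //.
move=> e0; have [d d0 acd] := acg _ e0.
have [U [oU NU Ud]] : exists U : set R,
    [/\ open U, N `<=` U & (lebesgue_measure U < d%:E)%E].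
  have d2 : 0 < d / 2 by rewrite divr_gt0.
  have [U [oU NU Ud]] := outer_measure_open_le N d2.
  exists U; split => //; apply: le_lt_trans Ud _.
  by move/negligible_outer_measure: negN => ->; rewrite add0e lte_fin; lra.
have mU : measurable (U : set (measurableTypeR R)) by exact: open_measurable.
(* The invariant keeps the list of intervals of [U] crossed so far, in increasing order and hence
   disjoint. Absolute continuity is applied once, to the complete list at b. *)
pose P x := exists k : nat, exists u v : nat -> R,
  [/\ forall i, (i < k)%N -> [/\ a <= u i, u i <= v i, v i <= x
        & `]u i, v i[ `<=` U],
      forall i j, (i < j)%N -> (j < k)%N -> v i <= u j &
      g x - g a <= F x - F a + e * (x - a) + \sum_(i < k) `|g (v i) - g (u i)|].
suff [k [u [v [uvb uvlt gb]]]] : P b.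
  have triv : trivIset setT (fun i : 'I_k => `]u i, v i[%classic).
    apply/trivIsetP => i j _ _ ij; apply/seteqP; split => // t [] /=.
    rewrite !in_itv /= => /andP[ut tv] /andP[ut' tv'].
    have [ltij|ltji|/val_inj eqij] := ltngtP i j; last by rewrite eqij eqxx in ij.
    - by have := uvlt _ _ ltij (ltn_ord j); rewrite leNgt (lt_trans ut' tv).
    - by have := uvlt _ _ ltji (ltn_ord i); rewrite leNgt (lt_trans ut tv').
  have uvab (i : 'I_k) : [/\ a <= u i, u i <= v i & v i <= b].
    by have [] := uvb i (ltn_ord i).
  have lend : \sum_(i < k) (v i - u i) < d.
    rewrite -lte_fin; apply: le_lt_trans Ud.
    by apply: sum_len_le_measure => // i; have [] := uvb i (ltn_ord i).
  have := acd k (fun i => u i) (fun i => v i) uvab triv lend.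
  move: gb; lra.
apply: (@continuous_induction _ a b P leab).
  exists 0%N, (fun=> 0), (fun=> 0); split => //; rewrite big_ord0; lra.
move=> c ac cb; have [Uc|nUc] := pselect (U c).
  (* Near a point of [U] the step from x to y is appended to the list; near any other point it is
     charged to [F]. *)
  have /nbhs_ballP [r /= r0 rU] : nbhs c U by exact: open_nbhs_nbhs.
  exists r => // x y ax xc cy yb yxr [k [u [v [uvb uvlt gx]]]].
  exists k.+1, (fun i => if i == k then x else u i),
    (fun i => if i == k then y else v i).
  have ne i : (i < k)%N -> (i == k) = false by move=> /ltn_eqF.
  split.
  - move=> i; rewrite ltnS leq_eqVlt => /orP[/eqP ->|ik].
      rewrite eqxx; split => //; first lra.
      move=> t /=; rewrite in_itv /= => /andP[xt ty]; apply: rU.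
      by rewrite /ball /= ltr_norml; apply/andP; split; lra.
    rewrite (ne _ ik); have [? ? ? ?] := uvb _ ik; split => //; lra.
  - move=> i j ij; rewrite ltnS leq_eqVlt => /orP[/eqP jk|jk].
      by rewrite jk eqxx ne -?jk//; have [] := uvb i; rewrite -?jk.
    by rewrite !ne ?(ltn_trans ij jk)//; exact: uvlt.
  - rewrite big_ord_recr /= eqxx (eq_bigr (fun i : 'I_k => `|g (v i) - g (u i)|));
      last by move=> i _; rewrite ne.
    have := ler_norm (g y - g x).
    have := homF x y ax (le_trans xc cy) yb.
    have : 0 <= e * (y - x) by rewrite mulr_ge0 ?subr_ge0 ?(le_trans xc cy) ?ltW.
    move: gx; lra.
have [r r0 rH] := loc c ac cb (fun Nc => nUc (NU _ Nc)) _ e0.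
exists r => // x y ax xc cy yb yxr [k [u [v [uvb uvlt gx]]]].
exists k, u, v; split => //.
  by move=> i ik; have [? ? ? ?] := uvb _ ik; split => //; lra.
have := rH x y ax xc cy yb yxr; move: gx; lra.
Qed.

Lemma count_levels_le (R : realType) (h : R) (N : nat) :
  \sum_(n < N) ((n.+1%:R <= h)%R%:R : R) <= `|h|.
Proof.
(* The bound by [N] is carried along because, when [N.+1 <= h], the new total is compared with
   [N.+1] and then with [h]. *)
suff [//] : \sum_(n < N) ((n.+1%:R <= h)%R%:R : R) <= `|h| /\
    \sum_(n < N) ((n.+1%:R <= h)%R%:R : R) <= N%:R :> R.
elim: N => [|N [IH1 IH2]]; first by rewrite big_ord0.
rewrite big_ord_recr /=; case: (leP _ h) => hN; last first.
  by rewrite mulr0n addr0; split => //; apply: le_trans IH2 _; rewrite ler_nat.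
have leN : \sum_(n < N) ((n.+1%:R <= h)%R%:R : R) + 1 <= N.+1%:R :> R.
  by rewrite -natr1 lerD2r.
by split => //; apply: (le_trans leN); apply: le_trans hN (ler_norm _).
Qed.

(* Layer cake: [sum_n mu {h >= n + 1} <= int |h|], so the superlevel sets have
   open neighbourhoods [U n] of summable measure; [F] adds up the measures
   of [U n `&` ]a, x]], plus [x] to absorb the fractional part of [h]. *)
Lemma integrable_majorant (R : realType) (a b : R) (h : R -> R) :
  completed_lebesgue_measure.-integrable `[a, b] (fun x => (h x)%:E) ->
  exists F : R -> R,
    (forall x y, a <= x -> x <= y -> y <= b -> F x <= F y) /\
    (forall c, a <= c -> c <= b -> exists2 d : R, 0 < d & forall x y,
     a <= x -> x <= c -> c <= y -> y <= b -> y - x < d ->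
     h c * (y - x) <= F y - F x).
Proof.
move=> hint; set cmu := completed_lebesgue_measure in hint.
set T := caratheodory_type (@wlength R idfun)^*%mu.
have mD : measurable (`[a, b]%classic : set T).
  by apply: sub_caratheodory; exact: measurable_itv.
have mh := measurable_int _ hint.
pose E n : set T := `[a, b]%classic `&` [set x | ((n.+1%:R)%:E <= (h x)%:E)%E].
have mE n : measurable (E n) by exact: emeasurable_fun_c_infty.
set M := (\int[cmu]_(x in `[a, b]%classic) `|(h x)%:E|)%E.
have Moo : (M < +oo)%E by move/integrableP : hint => [].
have sumE N : (\sum_(n < N) cmu (E n) <= M)%E.
  have -> : (\sum_(n < N) cmu (E n) =
      \int[cmu]_(x in `[a, b]%classic) (\sum_(n < N) (\1_(E n) x)%:E))%E.
    rewrite ge0_integral_sum //.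
    - apply: eq_bigr => i _; rewrite integral_indic //.
      by rewrite (setIidl (@subIsetl _ _ _)).
    - move=> n; apply/measurable_EFinP; exact: measurable_indic.
  rewrite /M; apply: ge0_le_integral => //.
  - by move=> x _; apply: sume_ge0 => n _; rewrite lee_fin.
  - apply: emeasurable_sum => n; apply/measurable_EFinP; exact: measurable_indic.
  - exact: measurableT_comp mh.
  - move=> x Dx; rewrite sumEFin lee_fin.
    apply: le_trans _ (count_levels_le (h x) N).
    apply: ler_sum => n _; rewrite indicE.
    by case: (boolP (x \in E n)) => [/set_mem [_ /=]|_]; rewrite ?lee_fin => // ->.
(* The errors 2^-(n+1) add up to 1, so the measures of the [U n] sum to at most [M] + 1. *)
have UE n : {U : set R | [/\ open U, E n `<=` U &
    (lebesgue_measure U <= cmu (E n) + (1 / (2 ^ n.+1)%:R)%:E)%E]}.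
  by apply/cid; apply: outer_measure_open_le; rewrite divr_gt0.
pose U n := sval (UE n).
have oU n : open (U n) by rewrite /U; case: (svalP (UE n)).
have EU n : E n `<=` U n by rewrite /U; case: (svalP (UE n)).
have muU n : (lebesgue_measure (U n) <= cmu (E n) + (1 / (2 ^ n.+1)%:R)%:E)%E.
  by rewrite /U; case: (svalP (UE n)).
have mU n : measurable (U n : set (measurableTypeR R)) by exact: open_measurable.
pose nu : {measure set (measurableTypeR R) -> \bar R} :=
  mseries (fun n => mrestr (@lebesgue_measure R) (mU n)) 0.
have nuoo : (nu setT < +oo)%E.
  apply: (@le_lt_trans _ _ (M + 1%:E)%E); last first.
    by rewrite lte_add_pinfty // ltry.
  rewrite /nu /mseries /=.
  apply: (@le_trans _ _
      (\sum_(0 <= n <oo) (cmu (E n) + (1 / (2 ^ n.+1)%:R)%:E))%E).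
    apply: lee_nneseries => // n _.
    by have := muU n; rewrite -{1}(setTI (U n)).
  apply: le_trans (epsilon_trick _ _ _) _ => //.
  rewrite leeD2r //; apply: lime_le; first exact: is_cvg_nneseries.
  by apply: nearW => N; rewrite big_mkord.
have mI x y : measurable (`]x, y]%classic : set (measurableTypeR R)).
  exact: measurable_itv.
have nufin (x y : R) : nu `]x, y]%classic \is a fin_num.
  rewrite ge0_fin_numE //; apply: le_lt_trans nuoo.
  by apply: le_measure; rewrite ?inE //; exact: mI.
pose F (x : R) := fine (nu `]a, x]%classic) + x.
have incF (x y : R) : a <= x -> x <= y -> F y - F x = fine (nu `]x, y]%classic) + (y - x).
  move=> ax xy; rewrite /F.
  rewrite (_ : `]a, y]%classic = `]a, x]%classic `|` `]x, y]%classic); last first.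
    by rewrite -itv_bndbnd_setU // bnd_simp.
  rewrite (measureU nu (mI a x) (mI x y)).
    by rewrite fineD; [ring | exact: nufin | exact: nufin].
  apply/seteqP; split=> // t [] /=; rewrite !in_itv /= => /andP[_ tx] /andP[xt _].
  by move: tx; rewrite leNgt xt.
have fnu0 x y : 0 <= fine (nu `]x, y]%classic) by apply: fine_ge0.
exists F; split => [x y ax xy yb|c ac cb].
  by rewrite -subr_ge0 incF // addr_ge0 // subr_ge0.
(* [c] belongs to [E n] for all n < k, so a short interval around c lies in these [U n] and has
   [nu]-measure at least k (y - x). The summand x of [F] covers the rest, since h c <= k + 1. *)
pose k := Num.truncn (h c).
have Uc : \forall x \near c, forall n : 'I_k, U n x.
  apply: (@filter_forall R 'I_k (fun n x => U n x) (nbhs c)) => n.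
  apply: open_nbhs_nbhs; split => //; apply: EU.
  split => /=; first by rewrite in_itv /= ac cb.
  by rewrite lee_fin -truncn_gt_nat ltn_ord.
move/nbhs_ballP : Uc => [d /= d0 dU]; exists d => // x y ax xc cy yb yxd.
have xy := le_trans xc cy; rewrite incF //.
have hk : h c <= k%:R + 1.
  by rewrite natr1 ltW // -truncn_le_nat.
apply: le_trans (ler_wpM2r _ hk) _; rewrite ?subr_ge0 //.
rewrite mulrDl mul1r lerD2r -lee_fin fineK //.
apply: (@le_trans _ _ (\sum_(0 <= n < k) mrestr lebesgue_measure (mU n) `]x, y]%classic)%E).
  rewrite big_mkord.
  rewrite (eq_bigr (fun _ => (y - x)%:E)); last first.
    move=> n _; rewrite /mrestr setIidl; last first.
      move=> t /=; rewrite in_itv /= => /andP[xt ty]; apply: dU.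
      by rewrite /ball /= ltr_norml; apply/andP; split; lra.
    rewrite lebesgue_measure_itv /= lte_fin -EFinB; case: ltP => // yx.
    by congr EFin; apply/esym/eqP; rewrite subr_eq0 eq_le yx xy.
  by rewrite sumEFin sumr_const card_ord mulr_natl.
by apply: nneseries_lim_ge.
Qed.

(** * Calculus of absolutely continuous functions *)

Section AbsContinuous.
Context (R : realType) (a b : R).
Implicit Types (f g : R -> R).

(** Common source of the closure properties below; two dominating functions are allowed so that sums
    and products fit. *)
Lemma ac_dominated f g1 g2 (K : R) :
  abs_continuous a b g1 -> abs_continuous a b g2 ->
  (forall x y, a <= x -> x <= y -> y <= b ->
    `|f y - f x| <= K * (`|g1 y - g1 x| + `|g2 y - g2 x|)) ->
  abs_continuous a b f.
Proof.
move=> ac1 ac2 fK e e0.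
have K1 : 0 < `|K| + 1 by rewrite ltr_wpDl.
pose e' := e / (`|K| + 1) / 2.
have e'0 : 0 < e' by rewrite !divr_gt0.
have [d1 d10 H1] := ac1 _ e'0; have [d2 d20 H2] := ac2 _ e'0.
exists (Num.min d1 d2); first by rewrite lt_min d10 d20.
move=> k u v uv triv; rewrite lt_min => /andP[/(H1 _ _ _ uv triv) S1 /(H2 _ _ _ uv triv) S2].
set s1 := \sum_i _ in S1; set s2 := \sum_i _ in S2.
have le1 : \sum_(i < k) `|f (v i) - f (u i)| <= (`|K| + 1) * (s1 + s2).
  rewrite /s1 /s2 -big_split /= mulr_sumr; apply: ler_sum => i _.
  have [ua uvi vb] := uv i; apply: le_trans (fK _ _ ua uvi vb) _.
  by apply: ler_wpM2r; rewrite ?addr_ge0 // ler_wpDr // ler_norm.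
apply: le_lt_trans le1 _; rewrite -ltr_pdivlMl // mulrC.
rewrite (_ : e / _ = e' + e'); first exact: ltrD.
by rewrite /e'; field; rewrite gt_eqF.
Qed.

Lemma ac_cst (c : R) : abs_continuous a b (fun=> c).
Proof.
move=> e e0; exists 1 => // k u v _ _ _; rewrite big1 // => i _.
by rewrite subrr normr0.
Qed.

Lemma ac_id : abs_continuous a b id.
Proof.
move=> e e0; exists e => // k u v uv _; apply: le_lt_trans.
by apply: ler_sum => i _; have [_ ? _] := uv i; rewrite ger0_norm // subr_ge0.
Qed.

Lemma acN f : abs_continuous a b f -> abs_continuous a b (fun x => - f x).
Proof.
move=> acf; apply: (@ac_dominated _ f f 1) => // x y _ _ _.
rewrite mul1r -opprD normrN; by rewrite lerDl.
Qed.

Lemma acD f g : abs_continuous a b f -> abs_continuous a b g ->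
  abs_continuous a b (fun x => f x + g x).
Proof.
move=> acf acg; apply: (@ac_dominated _ f g 1) => // x y _ _ _.
rewrite mul1r (_ : _ - _ = (f y - f x) + (g y - g x)); last by ring.
exact: ler_normD.
Qed.

Lemma ac_uniform f : abs_continuous a b f -> forall e : R, 0 < e ->
  exists2 d : R, 0 < d & forall x y, a <= x -> x <= b -> a <= y -> y <= b ->
    `|y - x| < d -> `|f y - f x| < e.
Proof.
move=> acf e e0; have [d d0 H] := acf _ e0; exists d => //.
suff W x y : a <= x -> x <= y -> y <= b -> `|y - x| < d -> `|f y - f x| < e.
  move=> x y ax xb ay yb xyd; have [xy|/ltW yx] := leP x y; first exact: W.
  by rewrite distrC; apply: W => //; rewrite distrC.
move=> ax xy yb xyd.
have := H 1%N (fun=> x) (fun=> y); rewrite !big_ord1; apply => //.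
  by apply/trivIsetP => i j _ _; rewrite !ord1.
by rewrite -(@ger0_norm _ (y - x)) // subr_ge0.
Qed.

(** Continuous induction replaces compactness: each short step raises the bound by at most 1. *)
Lemma ac_bounded f : abs_continuous a b f ->
  exists2 M : R, 0 < M & forall x, a <= x -> x <= b -> `|f x| <= M.
Proof.
move=> acf; have [leab|ltba] := leP a b; last first.
  by exists 1 => // x ax /(le_trans ax); rewrite leNgt ltba.
have [d d0 H] := ac_uniform acf ltr01.
pose P x := exists2 M : R, 0 < M & forall t, a <= t -> t <= x -> `|f t| <= M.
apply: (@continuous_induction _ a b P leab).
  exists (`|f a| + 1) => [|t at_ ta]; first by rewrite ltr_wpDl.
  by rewrite (_ : t = a) ?lerDl//; apply/le_anti/andP.
move=> c ac cb; exists d => // x y ax xc cy yb yxd [M M0 MP].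
exists (M + 1) => [|t at_ ty]; first by rewrite ltr_wpDl // ltW.
have [tx|xt] := leP t x; first by apply: le_trans (MP t at_ tx) _; rewrite lerDl.
have := H x t ax (le_trans xc cb) at_ (le_trans ty yb).
rewrite ger0_norm ?subr_ge0 ?(ltW xt) // => /(_ (le_lt_trans (lerB ty (lexx x)) yxd)).
have := MP x ax (lexx x); have := ler_normD (f x) (f t - f x).
rewrite addrC subrK; lra.
Qed.

(** Again continuous induction: near c the modulus stays above |f c| / 2. *)
Lemma ac_nonzero f : abs_continuous a b f ->
  (forall x, a <= x -> x <= b -> f x != 0) ->
  exists2 m : R, 0 < m & forall x, a <= x -> x <= b -> m <= `|f x|.
Proof.
move=> acf f0; have [leab|ltba] := leP a b; last first.
  by exists 1 => // x ax /(le_trans ax); rewrite leNgt ltba.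
pose P x := exists2 m : R, 0 < m & forall t, a <= t -> t <= x -> m <= `|f t|.
apply: (@continuous_induction _ a b P leab).
  exists `|f a| => [|t at_ ta]; first by rewrite normr_gt0 f0.
  by rewrite (_ : t = a) //; apply/le_anti/andP.
move=> c ac cb; have fc0 : 0 < `|f c| by rewrite normr_gt0 f0.
have [d d0 H] := ac_uniform acf (divr_gt0 fc0 (@ltr0Sn _ 1)).
exists d => // x y ax xc cy yb yxd [m m0 mP].
exists (Num.min m (`|f c| / 2)) => [|t at_ ty].
  by rewrite lt_min m0 divr_gt0.
rewrite ge_min; have [tx|xt] := leP t x; first by rewrite (mP t at_ tx).
apply/orP; right.
have := H c t ac cb at_ (le_trans ty yb).
have -> : `|t - c| < d by rewrite ltr_norml; apply/andP; split; lra.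
move=> /(_ isT); have := ler_normD (f t) (f c - f t).
rewrite addrC subrK distrC; lra.
Qed.

Lemma acM f g : abs_continuous a b f -> abs_continuous a b g ->
  abs_continuous a b (fun x => f x * g x).
Proof.
move=> acf acg; have [Mf Mf0 fM] := ac_bounded acf; have [Mg Mg0 gM] := ac_bounded acg.
apply: (@ac_dominated _ f g (Mf + Mg)) => // x y ax xy yb.
rewrite (_ : _ - _ = f y * (g y - g x) + (f y - f x) * g x); last by ring.
apply: le_trans (ler_normD _ _) _; rewrite !normrM.
have A1 : `|f y| * `|g y - g x| <= Mf * `|g y - g x|.
  by apply: ler_wpM2r => //; apply: fM => //; apply: le_trans xy.
have A2 : `|f y - f x| * `|g x| <= `|f y - f x| * Mg.
  by apply: ler_wpM2l => //; apply: gM => //; apply: le_trans xy yb.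
have : 0 <= Mf * `|f y - f x| by rewrite mulr_ge0 // ltW.
have : 0 <= Mg * `|g y - g x| by rewrite mulr_ge0 // ltW.
nra.
Qed.

Lemma acV f : abs_continuous a b f ->
  (forall x, a <= x -> x <= b -> f x != 0) ->
  abs_continuous a b (fun x => (f x)^-1).
Proof.
move=> acf f0; have [m m0 fm] := ac_nonzero acf f0.
apply: (@ac_dominated _ f f (m^-1 ^+ 2)) => // x y ax xy yb.
have fx := f0 _ ax (le_trans xy yb); have fy := f0 _ (le_trans ax xy) yb.
rewrite (_ : _ - _ = (f x)^-1 * (f y)^-1 * (f x - f y)); last first.
  by rewrite mulrBr mulrAC mulVf // mul1r -mulrA mulVf // mulr1.
rewrite normrM distrC; apply: ler_pM => //; last by rewrite lerDl.
rewrite normrM !normfV expr2; apply: ler_pM; rewrite ?invr_ge0 // lef_pV2 ?posrE ?normr_gt0 //.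
  by apply: fm => //; apply: le_trans yb.
by apply: fm => //; apply: le_trans xy.
Qed.

(** On [e, oo) the logarithm is Lipschitz with constant 1 / e, by ln (1 + x) <= x. *)
Lemma ac_ln f (e : R) : 0 < e -> (forall x, e <= f x) ->
  abs_continuous a b f -> abs_continuous a b (fun x => ln (f x)).
Proof.
move=> e0 fe acf.
apply: (@ac_dominated _ f f e^-1) => // x y _ _ _.
have lnB s t : e <= s -> e <= t -> ln t - ln s <= e^-1 * `|t - s|.
  move=> es et; have s0 := lt_le_trans e0 es; have t0 := lt_le_trans e0 et.
  rewrite -ln_div ?posrE // (_ : t / s = 1 + (t - s) / s); last first.
    by rewrite mulrBl mulfV ?gt_eqF // addrC subrK.
  have gtm1 : -1 < (t - s) / s.
    by rewrite mulrBl mulfV ?gt_eqF // ltrBDl subrr divr_gt0.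
  apply: (le_trans (le_ln1Dx gtm1)); apply: (le_trans (ler_norm _)).
  rewrite normrM mulrC; apply: ler_wpM2r => //.
  by rewrite gtr0_norm ?invr_gt0 // lef_pV2.
have l1 := lnB _ _ (fe x) (fe y); have l2 := lnB _ _ (fe y) (fe x).
rewrite [`|f x - f y|]distrC in l2.
have e1 : 0 <= e^-1 * `|f y - f x| by rewrite mulr_ge0 // invr_ge0 ltW.
by rewrite ler_norml; apply/andP; split; lra.
Qed.

End AbsContinuous.

(** * Complex-valued functions of a real variable *)

Section ComplexScalar.
Context (R : realType).
Implicit Types (f g : R -> R[i]).

(** Each entry of [mx_abs_continuous] unfolds to this, and each entry of [is_mx_derive] to
    [cderive], so the scalar lemmas apply to entries by conversion. *)
Definition cac (a b : R) f :=
  abs_continuous a b (fun t => complex.Re (f t)) /\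
  abs_continuous a b (fun t => complex.Im (f t)).

Definition cderive f (x : R) (d : R[i]) :=
  is_derive x 1 (fun t => complex.Re (f t)) (complex.Re d) /\
  is_derive x 1 (fun t => complex.Im (f t)) (complex.Im d).

Lemma ReM (z w : R[i]) :
  complex.Re (z * w) = complex.Re z * complex.Re w - complex.Im z * complex.Im w.
Proof. by case: z; case: w. Qed.

Lemma ImM (z w : R[i]) :
  complex.Im (z * w) = complex.Re z * complex.Im w + complex.Im z * complex.Re w.
Proof. by case: z; case: w. Qed.

Lemma ReD (z w : R[i]) : complex.Re (z + w) = complex.Re z + complex.Re w.
Proof. by case: z; case: w. Qed.

Lemma ImD (z w : R[i]) : complex.Im (z + w) = complex.Im z + complex.Im w.
Proof. by case: z; case: w. Qed.

Lemma conj_complexE (z : R[i]) : Num.conj z = (complex.Re z -i* complex.Im z)%C.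
Proof. by case: z. Qed.

Lemma cac_cst a b c : cac a b (fun=> c).
Proof. by split; exact: ac_cst. Qed.

Lemma cacD a b f g : cac a b f -> cac a b g -> cac a b (fun x => f x + g x).
Proof.
move=> [f1 f2] [g1 g2]; split.
  by under eq_fun do rewrite ReD; exact: (acD f1 g1).
by under eq_fun do rewrite ImD; exact: (acD f2 g2).
Qed.

Lemma cacM a b f g : cac a b f -> cac a b g -> cac a b (fun x => f x * g x).
Proof.
move=> [f1 f2] [g1 g2]; split.
  by under eq_fun do rewrite ReM; exact: (acD (acM f1 g1) (acN (acM f2 g2))).
by under eq_fun do rewrite ImM; exact: (acD (acM f1 g2) (acM f2 g1)).
Qed.

Lemma cac_conj a b f : cac a b f -> cac a b (fun x => Num.conj (f x)).
Proof.
move=> [f1 f2]; split; under eq_fun do rewrite conj_complexE //=.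
  exact: f1.
exact: (acN f2).
Qed.

(** Reduces complex inversion to that of a real function, where [acV] and [is_deriveV] are
    available. *)
Lemma invc_conj (z : R[i]) : z^-1 =
  Num.conj z * ((complex.Re z ^+ 2 + complex.Im z ^+ 2)^-1)%:C.
Proof.
case: z => x y; rewrite conj_complexE /=.
rewrite -[LHS]/((x / (x ^+ 2 + y ^+ 2)) -i* (y / (x ^+ 2 + y ^+ 2)))%C.
by apply/eqP; rewrite eq_complex /= !mulr0 !subr0 add0r mulNr !eqxx.
Qed.

Lemma normsq_neq0 (z : R[i]) : z != 0 -> complex.Re z ^+ 2 + complex.Im z ^+ 2 != 0.
Proof.
apply: contra; rewrite paddr_eq0 ?sqr_ge0 // !sqrf_eq0 => /andP[/eqP zr /eqP zi].
by case: z zr zi => x y /= -> ->.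
Qed.

Lemma cacV a b f : cac a b f -> (forall x, a <= x -> x <= b -> f x != 0) ->
  cac a b (fun x => (f x)^-1).
Proof.
move=> [f1 f2] f0; under [X in cac _ _ X]eq_fun do rewrite invc_conj.
apply: cacM; first exact: cac_conj.
split => /=; last exact: ac_cst.
apply: acV => [|x ax xb]; last by apply: normsq_neq0; exact: f0.
exact: (acD (acM f1 f1) (acM f2 f2)).
Qed.

Lemma cderive_cst c x : cderive (fun=> c) x 0.
Proof. by split; exact: is_derive_cst. Qed.

Lemma cderiveD f g x df dg : cderive f x df -> cderive g x dg ->
  cderive (fun x => f x + g x) x (df + dg).
Proof.
move=> [f1 f2] [g1 g2]; split.
  by rewrite ReD; under eq_fun do rewrite ReD; exact: (is_deriveD f1 g1).
by rewrite ImD; under eq_fun do rewrite ImD; exact: (is_deriveD f2 g2).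
Qed.

Lemma cderiveM f g x df dg : cderive f x df -> cderive g x dg ->
  cderive (fun x => f x * g x) x (df * g x + f x * dg).
Proof.
move=> [f1 f2] [g1 g2]; split.
  under eq_fun do rewrite ReM.
  apply: (is_derive_eq (is_deriveB (is_deriveM f1 g1) (is_deriveM f2 g2))).
  by rewrite ReD !ReM /GRing.scale /=; ring.
under eq_fun do rewrite ImM.
apply: (is_derive_eq (is_deriveD (is_deriveM f1 g2) (is_deriveM f2 g1))).
by rewrite ImD !ImM /GRing.scale /=; ring.
Qed.

Lemma cderive_conj f x df : cderive f x df ->
  cderive (fun x => Num.conj (f x)) x (Num.conj df).
Proof.
move=> [f1 f2]; rewrite conj_complexE; split => /=; under eq_fun do rewrite conj_complexE //=.
  exact: f1.
exact: (is_deriveN f2).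
Qed.

(** Existence suffices: the derivative of a matrix inverse is identified later from
    [invmx (f t) *m f t = 1]. *)
Lemma cderiveV f x df : f x != 0 -> cderive f x df ->
  exists d, cderive (fun x => (f x)^-1) x d.
Proof.
move=> f0 fd; under [X in exists d, cderive X _ _]eq_fun do rewrite invc_conj.
have [f1 f2] := fd.
have [d D] : exists d : R, is_derive x 1
    (fun t => (complex.Re (f t) ^+ 2 + complex.Im (f t) ^+ 2)^-1) d.
  eexists; exact: (@is_deriveV R
    (fun t => complex.Re (f t) ^+ 2 + complex.Im (f t) ^+ 2) x _ 1 (normsq_neq0 f0)
    (is_deriveD (is_deriveM f1 f1) (is_deriveM f2 f2))).
have Dc : cderive (fun t => ((complex.Re (f t) ^+ 2 + complex.Im (f t) ^+ 2)^-1)%:C)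
    x d%:C.
  by split => /=; [exact: D | exact: is_derive_cst].
by eexists; exact: (cderiveM (cderive_conj fd) Dc).
Qed.

Lemma cderive_unique f x d1 d2 : cderive f x d1 -> cderive f x d2 -> d1 = d2.
Proof.
move=> [r1 i1] [r2 i2]; apply/eqP; rewrite eq_complex.
rewrite -(@derive_val _ _ _ _ _ _ _ r1) -(@derive_val _ _ _ _ _ _ _ r2).
by rewrite -(@derive_val _ _ _ _ _ _ _ i1) -(@derive_val _ _ _ _ _ _ _ i2) !eqxx.
Qed.

Lemma near_cderive f g x d : (\forall t \near x, f t = g t) ->
  cderive f x d -> cderive g x d.
Proof.
move=> fg [f1 f2]; split.
  by apply: near_eq_is_derive f1; apply: filterS fg => t ->.
by apply: near_eq_is_derive f2; apply: filterS fg => t ->.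
Qed.

Lemma cderive_near_neq0 f x d : cderive f x d -> f x != 0 -> \forall t \near x, f t != 0.
Proof.
move=> [f1 f2] f0.
have /derivable1_diffP/differentiable_continuous c1 := @ex_derive _ _ _ _ _ _ _ f1.
have /derivable1_diffP/differentiable_continuous c2 := @ex_derive _ _ _ _ _ _ _ f2.
have n0 := normsq_neq0 f0.
have c3 : {for x, continuous (fun t => complex.Re (f t) ^+ 2 + complex.Im (f t) ^+ 2)}.
  by apply: cvgD; apply: cvgM.
have nn : \forall t \near x, complex.Re (f t) ^+ 2 + complex.Im (f t) ^+ 2 != 0.
  exact: (cvgr_neq0 _ c3 n0).
apply: filterS nn => t; apply: contra => /eqP ->.
by rewrite /= expr0n /= addr0.
Qed.

End ComplexScalar.

Section FunctionAlgebra.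
Context (R : realType) (K : (R -> R[i]) -> Prop).
Hypothesis K_cst : forall c, K (fun=> c).
Hypothesis K_add : forall f g, K f -> K g -> K (fun x => f x + g x).
Hypothesis K_mul : forall f g, K f -> K g -> K (fun x => f x * g x).

Lemma closed_sum (I : Type) (r : seq I) (P : pred I) (F : I -> R -> R[i]) :
  (forall i, K (F i)) -> K (fun x => \sum_(i <- r | P i) F i x).
Proof.
move=> KF; elim: r => [|i r IH].
  by under eq_fun do rewrite big_nil; exact: K_cst.
under eq_fun do rewrite big_cons; case: (P i) => //; exact: (K_add (KF i) IH).
Qed.

Lemma closed_prod (I : Type) (r : seq I) (P : pred I) (F : I -> R -> R[i]) :
  (forall i, K (F i)) -> K (fun x => \prod_(i <- r | P i) F i x).
Proof.
move=> KF; elim: r => [|i r IH].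
  by under eq_fun do rewrite big_nil; exact: K_cst.
under eq_fun do rewrite big_cons; case: (P i) => //; exact: (K_mul (KF i) IH).
Qed.

(** Determinants and cofactors are polynomials in the entries. [K] will be absolute continuity on
    [a, b], and also differentiability at a point. *)
Lemma closed_det n (f : R -> 'M[R[i]]_n) :
  (forall i j, K (fun x => f x i j)) -> K (fun x => \det (f x)).
Proof.
move=> Kf; apply: closed_sum => s.
by apply: K_mul; [exact: K_cst | apply: closed_prod].
Qed.

Lemma closed_adj n (f : R -> 'M[R[i]]_n) i j :
  (forall i j, K (fun x => f x i j)) -> K (fun x => (\adj (f x)) i j).
Proof.
move=> Kf; under eq_fun do rewrite mxE.
apply: K_mul; first exact: K_cst.
by apply: closed_det => k l; under eq_fun do rewrite !mxE.
Qed.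
End FunctionAlgebra.

Section AlmostEverywhere.
Context (R : realType).
Implicit Types P Q S : R -> Prop.

Lemma ae_imply P Q : (forall x, P x -> Q x) ->
  {ae lebesgue_measure, forall x : R, P x} -> {ae lebesgue_measure, forall x : R, Q x}.
Proof.
exact: (@filterS _ (almost_everywhere (@lebesgue_measure R)) (ae_filter_ringOfSetsType _)).
Qed.

Lemma ae_imply2 P Q S : (forall x, P x -> Q x -> S x) ->
  {ae lebesgue_measure, forall x : R, P x} ->
  {ae lebesgue_measure, forall x : R, Q x} ->
  {ae lebesgue_measure, forall x : R, S x}.
Proof.
exact: (@filterS2 _ (almost_everywhere (@lebesgue_measure R)) (ae_filter_ringOfSetsType _)).
Qed.

Lemma ae_all P : (forall x, P x) -> {ae lebesgue_measure, forall x : R, P x}.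
Proof.
by move=> HP; apply: (@nearW _ (almost_everywhere (@lebesgue_measure R)) _
  (ae_filter_ringOfSetsType _)).
Qed.
End AlmostEverywhere.

(** * Matrix-valued functions *)

Section MatrixCalculus.
Context (R : realType).

Lemma cac_ext (a b : R) (f g : R -> R[i]) :
  (forall x, a <= x -> x <= b -> f x = g x) -> cac a b f -> cac a b g.
Proof.
move=> fg [f1 f2]; split=> e e0.
  have [d d0 H] := f1 e e0; exists d => // k u v uv tr lt; have := H k u v uv tr lt.
  rewrite (eq_bigr (fun i => `|complex.Re (g (v i)) - complex.Re (g (u i))|)) //.
  by move=> i _; have [ua uvi vb] := uv i; rewrite !fg //; lra.
have [d d0 H] := f2 e e0; exists d => // k u v uv tr lt; have := H k u v uv tr lt.
rewrite (eq_bigr (fun i => `|complex.Im (g (v i)) - complex.Im (g (u i))|)) //.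
by move=> i _; have [ua uvi vb] := uv i; rewrite !fg //; lra.
Qed.

Lemma cderive_sum (I : Type) (r : seq I) (F : I -> R -> R[i]) (dF : I -> R[i]) x :
  (forall i, cderive (F i) x (dF i)) ->
  cderive (fun t => \sum_(i <- r) F i t) x (\sum_(i <- r) dF i).
Proof.
move=> dFi; elim: r => [|i r IH].
  by under eq_fun do rewrite big_nil; rewrite big_nil; exact: cderive_cst.
under eq_fun do rewrite big_cons; rewrite big_cons; exact: (cderiveD (dFi i) IH).
Qed.

Lemma is_mx_derive_cst p q (c : 'M[R[i]]_(p, q)) x : is_mx_derive (fun=> c) x 0.
Proof. by move=> i j; rewrite mxE; exact: cderive_cst. Qed.

Lemma is_mx_deriveD p q (f g : R -> 'M[R[i]]_(p, q)) x df dg :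
  is_mx_derive f x df -> is_mx_derive g x dg ->
  is_mx_derive (fun t => f t + g t) x (df + dg).
Proof.
move=> Hf Hg i j.
rewrite -/(cderive (fun t => (f t + g t) i j) x _).
by under eq_fun do rewrite mxE; rewrite mxE; exact: (cderiveD (Hf i j) (Hg i j)).
Qed.

Lemma is_mx_deriveM p q r (f : R -> 'M[R[i]]_(p, q)) (g : R -> 'M[R[i]]_(q, r))
    x df dg :
  is_mx_derive f x df -> is_mx_derive g x dg ->
  is_mx_derive (fun t => f t *m g t) x (df *m g x + f x *m dg).
Proof.
move=> Hf Hg i j.
rewrite -/(cderive (fun t => (f t *m g t) i j) x _).
under eq_fun do rewrite mxE.
rewrite !mxE -big_split /=; apply: cderive_sum => k; exact: (cderiveM (Hf i k) (Hg k j)).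
Qed.

Lemma is_mx_derive_adj p q (f : R -> 'M[R[i]]_(p, q)) x df :
  is_mx_derive f x df -> is_mx_derive (fun t => (f t)^t*) x (df^t*).
Proof.
move=> Hf i j.
rewrite -/(cderive (fun t => ((f t)^t*) i j) x _).
under eq_fun do rewrite !mxE.
by rewrite !mxE; exact: (cderive_conj (Hf j i)).
Qed.

Lemma is_mx_derive_unique p q (f : R -> 'M[R[i]]_(p, q)) x d1 d2 :
  is_mx_derive f x d1 -> is_mx_derive f x d2 -> d1 = d2.
Proof. by move=> H1 H2; apply/matrixP => i j; exact: (cderive_unique (H1 i j) (H2 i j)). Qed.

Lemma near_is_mx_derive p q (f g : R -> 'M[R[i]]_(p, q)) x d :
  (\forall t \near x, f t = g t) -> is_mx_derive f x d -> is_mx_derive g x d.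
Proof.
move=> fg Hf i j; apply: near_cderive (Hf i j).
by apply: filterS fg => t ->.
Qed.

Lemma invmxE n (A : 'M[R[i]]_n) i j : A \in unitmx ->
  (invmx A) i j = (\det A)^-1 * (\adj A) i j.
Proof. by move=> uA; rewrite /invmx uA mxE. Qed.

Lemma unitmx_det n (A : 'M[R[i]]_n) : (A \in unitmx) = (\det A != 0).
Proof. by rewrite unitmxE unitfE. Qed.

(** Cramer's rule yields some derivative X; differentiating [invmx (f t) *m f t = 1], valid near x,
    then determines X. *)
Lemma is_mx_derive_inv n (f : R -> 'M[R[i]]_n) x df :
  f x \in unitmx -> is_mx_derive f x df ->
  is_mx_derive (fun t => invmx (f t)) x (- (invmx (f x) *m df *m invmx (f x))).
Proof.
move=> fx Hf.
pose K (g : R -> R[i]) := exists d, cderive g x d.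
have Kc c : K (fun=> c) by exists 0; exact: cderive_cst.
have KD g h : K g -> K h -> K (fun t => g t + h t).
  by move=> [d1 D1] [d2 D2]; exists (d1 + d2); exact: cderiveD.
have KM g h : K g -> K h -> K (fun t => g t * h t).
  by move=> [d1 D1] [d2 D2]; eexists; exact: (cderiveM D1 D2).
have Kf i j : K (fun t => f t i j) by eexists; exact: (Hf i j).
have [dd Ddet] := closed_det Kc KD KM Kf.
have det0 : \det (f x) != 0 by rewrite -unitmx_det.
have nu : \forall t \near x, f t \in unitmx.
  by apply: filterS (cderive_near_neq0 Ddet det0) => t; rewrite -unitmx_det.
have [X HX] : exists X, is_mx_derive (fun t => invmx (f t)) x X.
  have inv_ij i j : exists d, cderive (fun t => (invmx (f t)) i j) x d.
    have [d1 D1] := cderiveV det0 Ddet.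
    have [d2 D2] := closed_adj Kc KD KM i j Kf.
    eexists; apply: near_cderive (cderiveM D1 D2).
    by apply: filterS nu => t ft; rewrite invmxE.
  exists (\matrix_(i, j) sval (cid (inv_ij i j))) => i j; rewrite mxE.
  by case: (cid _).
have P1 := is_mx_deriveM HX Hf.
have P2 : is_mx_derive (fun t => invmx (f t) *m f t) x 0.
  apply: near_is_mx_derive (is_mx_derive_cst 1%:M x).
  by apply: filterS nu => t ft; rewrite mulVmx.
have /(congr1 (mulmxr (invmx (f x)))) := is_mx_derive_unique P1 P2.
rewrite /= mul0mx mulmxDl mulmxK // => /eqP; rewrite addr_eq0 => /eqP XE.
by rewrite -XE.
Qed.

Section AC.
Context (a b : R).

Lemma ac_derive_eq p q (f g g' : R -> 'M[R[i]]_(p, q)) :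
  {ae lebesgue_measure, forall x : R, x \in `[a, b] -> g x = g' x} ->
  ac_derive a b f g -> ac_derive a b f g'.
Proof.
move=> gg [acf df]; split => //.
by apply: ae_imply2 gg df => x gx dfx xab; rewrite -gx //; exact: dfx.
Qed.

Lemma ac_derive_cst p q (c : 'M[R[i]]_(p, q)) : ac_derive a b (fun=> c) (fun=> 0).
Proof.
split; first by move=> i j; exact: (cac_cst a b (c i j)).
by apply: ae_all => x _; exact: is_mx_derive_cst.
Qed.

Lemma ac_deriveD p q (f g df dg : R -> 'M[R[i]]_(p, q)) :
  ac_derive a b f df -> ac_derive a b g dg ->
  ac_derive a b (fun x => f x + g x) (fun x => df x + dg x).
Proof.
move=> [acf Df] [acg Dg]; split.
  move=> i j; rewrite -/(cac a b (fun t => (f t + g t) i j)).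
  by under eq_fun do rewrite mxE; exact: (cacD (acf i j) (acg i j)).
by apply: ae_imply2 Df Dg => x Hf Hg xab; apply: is_mx_deriveD; [exact: Hf|exact: Hg].
Qed.

Lemma ac_deriveM p q r (f df : R -> 'M[R[i]]_(p, q)) (g dg : R -> 'M[R[i]]_(q, r)) :
  ac_derive a b f df -> ac_derive a b g dg ->
  ac_derive a b (fun x => f x *m g x) (fun x => df x *m g x + f x *m dg x).
Proof.
move=> [acf Df] [acg Dg]; split.
  move=> i j; rewrite -/(cac a b (fun t => (f t *m g t) i j)).
  under eq_fun do rewrite mxE.
  apply: (closed_sum (cac_cst a b) (@cacD _ a b)) => k.
  exact: (cacM (acf i k) (acg k j)).
by apply: ae_imply2 Df Dg => x Hf Hg xab; apply: is_mx_deriveM; [exact: Hf|exact: Hg].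
Qed.

Lemma ac_deriveZ p q (c : R[i]) (f df : R -> 'M[R[i]]_(p, q)) :
  ac_derive a b f df -> ac_derive a b (fun x => c *: f x) (fun x => c *: df x).
Proof.
move=> Hf; have := ac_deriveM (ac_derive_cst c%:M) Hf.
under eq_fun do rewrite mul_scalar_mx.
by under [X in ac_derive _ _ _ X]eq_fun do rewrite mul0mx add0r mul_scalar_mx.
Qed.

Lemma ac_deriveB p q (f g df dg : R -> 'M[R[i]]_(p, q)) :
  ac_derive a b f df -> ac_derive a b g dg ->
  ac_derive a b (fun x => f x - g x) (fun x => df x - dg x).
Proof.
move=> Hf Hg; have := ac_deriveD Hf (ac_deriveZ (-1) Hg).
under eq_fun do rewrite scaleN1r.
by under [X in ac_derive _ _ _ X]eq_fun do rewrite scaleN1r.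
Qed.

Lemma ac_derive_adj p q (f df : R -> 'M[R[i]]_(p, q)) :
  ac_derive a b f df -> ac_derive a b (fun x => (f x)^t*) (fun x => (df x)^t*).
Proof.
move=> [acf Df]; split.
  move=> i j; rewrite -/(cac a b (fun t => ((f t)^t*) i j)).
  by under eq_fun do rewrite !mxE; exact: (cac_conj (acf j i)).
by apply: ae_imply Df => x Hf xab; apply: is_mx_derive_adj; exact: Hf.
Qed.

Lemma ac_derive_id n : ac_derive a b (fun x => x%:C%:M : 'M[R[i]]_n) (fun=> 1%:M).
Proof.
have idc i j x : ((x : R)%:C%:M : 'M[R[i]]_n) i j = x%:C * (i == j)%:R.
  by rewrite mxE mulr_natr.
split.
  move=> i j; rewrite -/(cac a b (fun t => (t%:C%:M : 'M[R[i]]_n) i j)).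
  under eq_fun do rewrite idc; apply: (@cacM _ a b (fun x => x%:C)).
    by split => /=; [exact: ac_id | exact: ac_cst].
  exact: cac_cst.
apply: ae_all => x _ i j.
rewrite -/(cderive (fun t => (t%:C%:M : 'M[R[i]]_n) i j) x _).
under eq_fun do rewrite idc.
have D : cderive (fun t : R => t%:C) x 1.
  by split => /=; [exact: is_derive_id | exact: is_derive_cst].
have := cderiveM D (cderive_cst (i == j)%:R x).
by rewrite mul1r mulr0 addr0 [in (1%:M) i j]mxE.
Qed.

Lemma ac_derive_inv n (f df : R -> 'M[R[i]]_n) :
  (forall x, x \in `[a, b] -> f x \in unitmx) ->
  ac_derive a b f df ->
  ac_derive a b (fun x => invmx (f x)) (fun x => - (invmx (f x) *m df x *m invmx (f x))).
Proof.
move=> uf [acf Df]; split; last first.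
  apply: ae_imply Df => x Hf xab; apply: is_mx_derive_inv; first exact: uf.
  exact: Hf.
move=> i j; rewrite -/(cac a b (fun t => (invmx (f t)) i j)).
apply: (@cac_ext _ _ (fun t => (\det (f t))^-1 * (\adj (f t)) i j)).
  by move=> x ax xb; rewrite invmxE // uf // in_itv /= ax xb.
apply: cacM; last exact: (closed_adj (cac_cst a b) (@cacD _ a b) (@cacM _ a b)).
apply: cacV; first exact: (closed_det (cac_cst a b) (@cacD _ a b) (@cacM _ a b)).
by move=> x ax xb; rewrite -unitmx_det uf // in_itv /= ax xb.
Qed.
End AC.
End MatrixCalculus.

(** * Gronwall's inequality *)

Section AcIncrement.
Context (R : realType).
Implicit Types (g h F : R -> R).

(** [F] stands for a primitive of [h]. The inequality holds at every point, without an exceptional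
    set, and over intervals straddling c, as continuous induction requires. *)
Definition majorizes (a b : R) F h :=
  (forall x y, a <= x -> x <= y -> y <= b -> F x <= F y) /\
  (forall c, a <= c -> c <= b -> exists2 d : R, 0 < d & forall x y,
     a <= x -> x <= c -> c <= y -> y <= b -> y - x < d ->
     h c * (y - x) <= F y - F x).

(** With the slope function q of Caratheodory, g y - g x = q y (y - c) + q x (c - x), and q is close
    to l near c. *)
Lemma is_derive_straddle g (c l e : R) : is_derive c 1 g l -> 0 < e ->
  exists2 d : R, 0 < d & forall x y, x <= c -> c <= y -> y - x < d ->
    g y - g x <= l * (y - x) + e * (y - x).
Proof.
move=> /is_derive1_caratheodory [q [qE qc ql]] e0.
have := qc; move=> /cvgrPdist_lt /(_ e e0) /nbhs_ballP [d /= d0 dq].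
exists d => // x y xc cy yxd.
have qnear t : `|c - t| < d -> q t <= l + e.
  by move=> /dq /=; rewrite ql ltr_norml => /andP[? ?]; lra.
have qx : q x <= l + e by apply: qnear; rewrite ger0_norm; lra.
have qy : q y <= l + e by apply: qnear; rewrite ler0_norm; lra.
have := qE x; have := qE y => hy hx.
have : q y * (y - c) <= (l + e) * (y - c) by apply: ler_wpM2r; lra.
have : q x * (c - x) <= (l + e) * (c - x) by apply: ler_wpM2r; lra.
move=> h1 h2; have -> : g y - g x = q y * (y - c) + q x * (c - x).
  by rewrite -(subrKA (g c)) hy -[g c - g x]opprB hx; ring.
by rewrite -mulrDl (_ : y - x = (y - c) + (c - x)); [rewrite mulrDr; lra | ring].
Qed.

Lemma abs_continuousS (a b b' : R) g : b' <= b ->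
  abs_continuous a b g -> abs_continuous a b' g.
Proof.
move=> bb acg e e0; have [d d0 H] := acg e e0; exists d => // k u v uv; apply: H.
by move=> i; have [? ? ?] := uv i; split => //; apply: le_trans bb.
Qed.

(** Integrated form of g' <= K h, with the increment of [F] in the role of the integral of [h]. *)
Lemma ac_increment_majorized (a b K : R) g dg h F :
  a <= b -> 0 <= K -> abs_continuous a b g -> majorizes a b F h ->
  {ae lebesgue_measure, forall x : R, x \in `[a, b] ->
    is_derive x 1 g (dg x) /\ dg x <= K * h x} ->
  g b - g a <= K * (F b - F a).
Proof.
move=> leab K0 acg [monF locF] aeg; rewrite mulrBr.
apply: (ac_increment_le (F := fun x => K * F x) leab acg _ aeg).
  by move=> x y ax xy yb; apply: ler_wpM2l => //; exact: monF.
move=> c ac cb nN e e0.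
have [dgc dgh] : is_derive c 1 g (dg c) /\ dg c <= K * h c.
  apply: contrapT => nd; apply: nN => /=; apply: contra_not nd; apply.
  by rewrite in_itv /= ac cb.
have [d1 d10 H1] := is_derive_straddle dgc e0.
have [d2 d20 H2] := locF c ac cb.
exists (Num.min d1 d2); first by rewrite lt_min d10 d20.
move=> x y ax xc cy yb; rewrite lt_min => /andP[l1 l2].
have := H1 x y xc cy l1; have := H2 x y ax xc cy yb l2.
move/(ler_wpM2l K0).
have : dg c * (y - x) <= K * h c * (y - x) by apply: ler_wpM2r => //; lra.
rewrite mulrA mulrBr; lra.
Qed.

(** The increment bound with [F] and [h] zero, applied to the real and imaginary parts of each entry
    and to their negatives. *)
Lemma ac_derive0_const (a b : R) p q (f : R -> 'M[R[i]]_(p, q)) :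
  ac_derive a b f (fun=> 0) -> forall x, x \in `[a, b] -> f x = f a.
Proof.
move=> [acf Df] x; rewrite in_itv /= => /andP[ax xb].
have maj0 : majorizes a x (fun=> 0) (fun=> 0).
  split => // c _ _; exists 1 => // ? ? _ _ _ _ _; by rewrite mul0r subrr.
have const (g : R -> R) : abs_continuous a b g ->
    {ae lebesgue_measure, forall x : R, x \in `[a, b] -> is_derive x 1 g 0} ->
    g x = g a.
  move=> acg Dg.
  have acg' := abs_continuousS xb acg.
  have ab' y : y \in `[a, x] -> y \in `[a, b].
    by rewrite !in_itv /= => /andP[-> yx]; exact: le_trans xb.
  apply/le_anti/andP; split.
    rewrite -subr_le0 -[X in _ <= X](mul0r (0 - 0 : R)).
    apply: (ac_increment_majorized (dg := fun=> 0) ax (lexx 0) acg' maj0).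
    by apply: ae_imply Dg => y Hy /ab' /Hy; rewrite mul0r.
  rewrite -subr_le0 -[X in _ <= X](mul0r (0 - 0 : R)) -[g a]opprK -[X in _ - X]opprK.
  rewrite [X in X <= _]addrC opprK.
  apply: (ac_increment_majorized (dg := fun=> 0) ax (lexx 0) (acN acg') maj0).
  apply: ae_imply Dg => y Hy /ab' /Hy D; rewrite mul0r; split => //.
  by apply: is_derive_eq (is_deriveN D) _; rewrite oppr0.
apply/matrixP => i j; apply/eqP; rewrite eq_complex; apply/andP; split; apply/eqP.
  apply: (const (fun t => complex.Re (f t i j)) (acf i j).1).
  by apply: ae_imply Df => y Hy /Hy /(_ i j) []; rewrite mxE.
apply: (const (fun t => complex.Im (f t i j)) (acf i j).2).
by apply: ae_imply Df => y Hy /Hy /(_ i j) []; rewrite mxE.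
Qed.
End AcIncrement.

(** * A submultiplicative matrix norm *)

Section EntrySum.
Context (R : realType).
Local Notation normc := (@ComplexField.Normc.normc R).

Lemma norm_normc (z : R[i]) : `|z| = (normc z)%:C.
Proof. by case: z. Qed.

Lemma normc_ge0 (z : R[i]) : 0 <= normc z.
Proof. by case: z => x y; exact: sqrtr_ge0. Qed.

Lemma normcD (z w : R[i]) : normc (z + w) <= normc z + normc w.
Proof. exact: (@le_normcD _ z w). Qed.

Lemma normc_sum (I : Type) (r : seq I) (F : I -> R[i]) :
  normc (\sum_(i <- r) F i) <= \sum_(i <- r) normc (F i).
Proof.
elim: r => [|i r IH]; first by rewrite !big_nil ComplexField.Normc.normc0.
by rewrite !big_cons; apply: le_trans (normcD _ _) _; rewrite lerD2l.
Qed.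

Lemma normc_conj (z : R[i]) : normc (Num.conj z) = normc z.
Proof. by case: z => x y; rewrite conj_complexE /= sqrrN. Qed.

Lemma sqr_normc_ReIm (z : R[i]) : normc z ^+ 2 = complex.Re z ^+ 2 + complex.Im z ^+ 2.
Proof. by case: z => x y; rewrite /= sqr_sqrtr // addr_ge0 // sqr_ge0. Qed.

Lemma normc_le_ReIm (z : R[i]) : normc z <= `|complex.Re z| + `|complex.Im z|.
Proof.
rewrite -(@ler_pXn2r _ 2) ?nnegrE ?normc_ge0 ?addr_ge0 // sqr_normc_ReIm.
rewrite sqrrD !real_normK ?num_real // addrAC lerDl mulrn_wge0 // mulr_ge0 //.
Qed.

Lemma Re_le_normc (z : R[i]) : `|complex.Re z| <= normc z.
Proof.
rewrite -(@ler_pXn2r _ 2) ?nnegrE ?normc_ge0 // sqr_normc_ReIm.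
by rewrite real_normK ?num_real // lerDl sqr_ge0.
Qed.

Lemma Im_le_normc (z : R[i]) : `|complex.Im z| <= normc z.
Proof.
rewrite -(@ler_pXn2r _ 2) ?nnegrE ?normc_ge0 // sqr_normc_ReIm.
by rewrite real_normK ?num_real // lerDr sqr_ge0.
Qed.

(** Chosen because it is submultiplicative for all shapes and takes its values in [R], whereas
    [mx_norm] takes them in [R[i]]. *)
Definition nm p q (A : 'M[R[i]]_(p, q)) : R := \sum_i \sum_j normc (A i j).

Lemma nm_ge0 p q (A : 'M[R[i]]_(p, q)) : 0 <= nm A.
Proof. by apply: sumr_ge0 => i _; apply: sumr_ge0 => j _; exact: normc_ge0. Qed.

Lemma nmD p q (A B : 'M[R[i]]_(p, q)) : nm (A + B) <= nm A + nm B.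
Proof.
rewrite /nm -big_split /=; apply: ler_sum => i _; rewrite -big_split /=.
by apply: ler_sum => j _; rewrite mxE; exact: normcD.
Qed.

Lemma nmZ p q c (A : 'M[R[i]]_(p, q)) : nm (c *: A) = normc c * nm A.
Proof.
rewrite /nm mulr_sumr; apply: eq_bigr => i _; rewrite mulr_sumr.
by apply: eq_bigr => j _; rewrite mxE ComplexField.Normc.normcM.
Qed.

Lemma nmN p q (A : 'M[R[i]]_(p, q)) : nm (- A) = nm A.
Proof.
by apply: eq_bigr => i _; apply: eq_bigr => j _; rewrite mxE (@normcN _ (A i j)).
Qed.

Lemma nm_adj p q (A : 'M[R[i]]_(p, q)) : nm (A^t*) = nm A.
Proof.
rewrite /nm exchange_big /=; apply: eq_bigr => i _; apply: eq_bigr => j _.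
by rewrite !mxE normc_conj.
Qed.

Lemma normc_le_nm p q (A : 'M[R[i]]_(p, q)) i j : normc (A i j) <= nm A.
Proof.
rewrite /nm (bigD1 i) //= (bigD1 j) //= -addrA lerDl addr_ge0 //.
  by apply: sumr_ge0 => k _; exact: normc_ge0.
by apply: sumr_ge0 => k _; apply: sumr_ge0 => l _; exact: normc_ge0.
Qed.

Lemma nmM p q r (A : 'M[R[i]]_(p, q)) (B : 'M[R[i]]_(q, r)) : nm (A *m B) <= nm A * nm B.
Proof.
rewrite {1 2}/nm mulr_suml; apply: ler_sum => i _.
apply: (@le_trans _ _ (\sum_j \sum_k normc (A i k) * normc (B k j))).
  apply: ler_sum => j _; rewrite mxE; apply: le_trans (normc_sum _ _) _.
  by apply: ler_sum => k _; rewrite ComplexField.Normc.normcM.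
rewrite exchange_big mulr_suml /=; apply: ler_sum => k _.
rewrite -mulr_sumr; apply: ler_wpM2l; first exact: normc_ge0.
rewrite /nm (bigD1 k) //= lerDl.
by apply: sumr_ge0 => l _; apply: sumr_ge0 => m _; exact: normc_ge0.
Qed.

Lemma nm_eq0 p q (A : 'M[R[i]]_(p, q)) : nm A = 0 -> A = 0.
Proof.
move=> A0; apply/matrixP => i j; rewrite mxE; apply: ComplexField.Normc.eq0_normc.
by apply/le_anti; rewrite normc_ge0 -A0 normc_le_nm.
Qed.

Lemma mx_norm_le_nm p q (A : 'M[R[i]]_(p, q)) : mx_norm A <= (nm A)%:C.
Proof.
have [->|A0] := eqVneq A 0; first by rewrite mx_norm0 ler0c nm_ge0.
have mA0 : mx_norm A != 0 by apply: contra A0 => /eqP/mx_norm_eq0 ->.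
have [[i j] ->] := mx_norm_neq0 mA0.
by rewrite norm_normc lecR normc_le_nm.
Qed.

Lemma nm_le_mx_norm p q (A : 'M[R[i]]_(p, q)) (c : R) :
  mx_norm A <= c%:C -> nm A <= (p * q)%:R * c.
Proof.
move=> Ac.
have le_c i j : normc (A i j) <= c.
  rewrite -lecR -norm_normc; apply: le_trans Ac.
  by rewrite mx_normE -[leLHS]nngE num_le; exact: (le_bigmax _ _ (i, j)).
apply: (@le_trans _ _ (\sum_(i < p) \sum_(j < q) c)).
  by apply: ler_sum => i _; apply: ler_sum => j _.
by rewrite !sumr_const !card_ord -mulrnA mulnC mulr_natl.
Qed.

(** Cauchy-Schwarz against the constant vector, from 2 F s F t <= (F s)^2 + (F t)^2 summed over all
    pairs. *)
Lemma nm_sqr_le p q (A : 'M[R[i]]_(p, q)) :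
  nm A ^+ 2 <= (p * q)%:R * \sum_i \sum_j normc (A i j) ^+ 2.
Proof.
rewrite /nm !pair_bigA /=; set F := fun ij : 'I_p * 'I_q => normc (A ij.1 ij.2).
rewrite -/(F _); have -> : (p * q)%N = #|{: 'I_p * 'I_q}| by rewrite card_prod !card_ord.
rewrite (eq_bigr F) // [X in _ * X](eq_bigr (fun s => F s ^+ 2)) //.
rewrite expr2 mulr_suml.
apply: (@le_trans _ _ (\sum_s \sum_t (F s ^+ 2 + F t ^+ 2) / 2)).
  apply: ler_sum => s _; rewrite mulr_sumr; apply: ler_sum => t _.
  have := sqr_ge0 (F s - F t); rewrite sqrrB; lra.
set N := #|_|; set S := \sum_s F s ^+ 2.
have inner s : \sum_t (F s ^+ 2 + F t ^+ 2) / 2 = (F s ^+ 2 * N%:R + S) / 2.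
  by rewrite -mulr_suml big_split /= sumr_const mulr_natr.
rewrite (eq_bigr _ (fun s _ => inner s)) -mulr_suml big_split /= sumr_const.
by rewrite -mulr_suml -/S -mulr_natr le_eqVlt; apply/orP; left; apply/eqP; field.
Qed.
End EntrySum.

Section Gronwall.
Context (R : realType).
Local Notation normc := (@ComplexField.Normc.normc R).

Lemma nm_bounded (a b : R) p q (f : R -> 'M[R[i]]_(p, q)) :
  mx_abs_continuous a b f ->
  exists2 M : R, 0 < M & forall x, x \in `[a, b] -> nm (f x) <= M.
Proof.
move=> acf.
have entry (ij : 'I_p * 'I_q) : {M : R |
    0 < M /\ forall x, x \in `[a, b] -> normc (f x ij.1 ij.2) <= M}.
  apply/cid; have [M1 M10 H1] := ac_bounded (acf ij.1 ij.2).1.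
  have [M2 M20 H2] := ac_bounded (acf ij.1 ij.2).2.
  exists (M1 + M2); split; first exact: addr_gt0.
  move=> x; rewrite in_itv /= => /andP[ax xb].
  apply: le_trans (normc_le_ReIm _) _; apply: lerD; [exact: H1 | exact: H2].
exists (1 + \sum_i \sum_j sval (entry (i, j))).
  rewrite ltr_pwDl // sumr_ge0 // => i _; rewrite sumr_ge0 // => j _.
  by case: (entry _) => M /= [/ltW].
move=> x xab; rewrite /nm; apply: (@le_trans _ _ (\sum_i \sum_j sval (entry (i, j)))).
  apply: ler_sum => i _; apply: ler_sum => j _.
  by case: (entry _) => M /= [_]; exact.
by rewrite lerDr.
Qed.

Lemma mx_integrable_majorant (a b : R) p q (H : R -> 'M[R[i]]_(p, q)) :
  mx_integrable a b H ->
  exists F h, majorizes a b F h /\ forall x, nm (H x) <= h x.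
Proof.
move=> iH.
pose h x := \sum_i \sum_j (`|complex.Re (H x i j)| + `|complex.Im (H x i j)|).
have mD : measurable (`[a, b]%classic : set (caratheodory_type (@wlength R idfun)^*%mu)).
  by apply: sub_caratheodory; exact: measurable_itv.
have [F majF] : exists F, majorizes a b F h.
  apply: integrable_majorant.
  rewrite (_ : (fun x => (h x)%:E) = (fun x => \sum_i \sum_j
      ((`|complex.Re (H x i j)|)%:E + (`|complex.Im (H x i j)|)%:E))%E); last first.
    apply/funext => x; rewrite -sumEFin; apply: eq_bigr => i _.
    by rewrite -sumEFin; apply: eq_bigr.
  apply: integrable_sum => // i _; apply: integrable_sum => // j _.
  apply: integrableD => //; first exact: (integrable_norm (iH i j).1).
  exact: (integrable_norm (iH i j).2).
exists F, h; split => // x; apply: ler_sum => i _; apply: ler_sum => j _.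
exact: normc_le_ReIm.
Qed.

(** The Gronwall argument differentiates this square sum, because [nm] need not be differentiable
    where an entry vanishes. *)
Definition sumsq p q (A : 'M[R[i]]_(p, q)) : R := \sum_i \sum_j normc (A i j) ^+ 2.

Lemma sumsq_ge0 p q (A : 'M[R[i]]_(p, q)) : 0 <= sumsq A.
Proof. by apply: sumr_ge0 => i _; apply: sumr_ge0 => j _; exact: sqr_ge0. Qed.

Lemma ReS (I : Type) (r : seq I) (F : I -> R[i]) :
  complex.Re (\sum_(i <- r) F i) = \sum_(i <- r) complex.Re (F i).
Proof. by elim: r => [|i r IH]; rewrite ?big_nil // !big_cons ReD IH. Qed.

Lemma sumsq_Re p q (A : 'M[R[i]]_(p, q)) :
  sumsq A = complex.Re (\sum_i \sum_j Num.conj (A i j) * A i j).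
Proof.
rewrite ReS; apply: eq_bigr => i _; rewrite ReS; apply: eq_bigr => j _.
by rewrite sqr_normc_ReIm ReM conj_complexE /= mulNr opprK !expr2.
Qed.

(** The logarithmic derivative of [sumsq f + e] is at most 2 K p q h: the 2 comes from the product
    rule, and p q from comparing [nm] squared with [sumsq]. The shift [e] keeps the logarithm under
    control where f vanishes. *)
Lemma ac_gronwall_log (a b K e : R) p q (f df : R -> 'M[R[i]]_(p, q)) F h :
  a <= b -> 0 <= K -> (forall x, 0 <= h x) -> majorizes a b F h ->
  ac_derive a b f df ->
  {ae lebesgue_measure, forall x : R, x \in `[a, b] ->
     nm (df x) <= K * h x * nm (f x)} ->
  0 < e ->
  ln (sumsq (f b) + e) - ln (sumsq (f a) + e) <= 2 * K * (p * q)%:R * (F b - F a).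
Proof.
move=> leab K0 h0 majF [acf Df] dfK e0.
pose phi x := \sum_i \sum_j Num.conj (f x i j) * f x i j.
pose D x := \sum_i \sum_j (Num.conj (df x i j) * f x i j + Num.conj (f x i j) * df x i j).
have acphi : cac a b phi.
  apply: (closed_sum (cac_cst a b) (@cacD _ a b)) => i.
  apply: (closed_sum (cac_cst a b) (@cacD _ a b)) => j.
  exact: (cacM (cac_conj (acf i j)) (acf i j)).
have ac1 : abs_continuous a b (fun x => complex.Re (phi x) + e).
  exact: (acD acphi.1 (ac_cst a b e)).
have phie x : e <= complex.Re (phi x) + e.
  by rewrite -sumsq_Re lerDr sumsq_ge0.
rewrite (sumsq_Re (f b)) (sumsq_Re (f a)).
apply: (ac_increment_majorized
  (dg := fun x => (complex.Re (phi x) + e)^-1 * complex.Re (D x)) leab _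
  (ac_ln e0 phie ac1) majF); first by rewrite !mulr_ge0.
apply: ae_imply2 Df dfK => x Dfx Kx xab.
have phi0 := lt_le_trans e0 (phie x).
have [dre _] : cderive phi x (D x).
  apply: cderive_sum => i; apply: cderive_sum => j.
  have fij : cderive (fun t => f t i j) x (df x i j) := Dfx xab i j.
  exact: (cderiveM (cderive_conj fij) fij).
split.
  apply: (@is_derive1_comp _ (@ln R) (fun x => complex.Re (phi x) + e)).
    exact: is_derive1_ln.
  by apply: is_derive_eq (is_deriveD dre (is_derive_cst e x 1)) _; rewrite addr0.
rewrite mulrC ler_pdivrMr //.
have D2 : complex.Re (D x) <= 2 * (nm (df x) * nm (f x)).
  apply: le_trans (ler_norm _) _; apply: le_trans (Re_le_normc _) _.
  rewrite mulrA [2 * _]mulrC -mulrA {1}/nm mulr_suml.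
  apply: le_trans (normc_sum _ _) _; apply: ler_sum => i _.
  rewrite mulr_suml; apply: le_trans (normc_sum _ _) _; apply: ler_sum => j _.
  apply: le_trans (normcD _ _) _.
  rewrite !ComplexField.Normc.normcM !normc_conj [X in _ + X]mulrC.
  rewrite -mulr2n -[X in X <= _]mulr_natl mulrCA.
  apply: ler_wpM2l; first exact: normc_ge0.
  by apply: ler_wpM2l => //; exact: normc_le_nm.
apply: (le_trans D2).
have s1 := nm_sqr_le (f x); rewrite -/(sumsq _) in s1.
have s2 : sumsq (f x) <= complex.Re (phi x) + e by rewrite sumsq_Re lerDl ltW.
have Kh : 0 <= K * h x by rewrite mulr_ge0.
have t1 : nm (df x) * nm (f x) <= K * h x * (nm (f x) ^+ 2).
  by rewrite expr2 mulrA; apply: ler_wpM2r; [exact: nm_ge0 | exact: Kx].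
have t2 : (p * q)%:R * sumsq (f x) <= (p * q)%:R * (complex.Re (phi x) + e).
  by apply: ler_wpM2l.
have t3 := ler_wpM2l Kh (le_trans s1 t2).
rewrite (_ : _ * (_ + e) = 2 * (K * h x * ((p * q)%:R * (complex.Re (phi x) + e)))); last by ring.
by apply: ler_wpM2l => //; apply: le_trans t1 t3.
Qed.

Lemma ac_gronwall (a b K : R) p q (f df : R -> 'M[R[i]]_(p, q)) F h :
  a <= b -> 0 <= K -> (forall x, 0 <= h x) -> majorizes a b F h ->
  ac_derive a b f df ->
  {ae lebesgue_measure, forall x : R, x \in `[a, b] ->
     nm (df x) <= K * h x * nm (f x)} ->
  nm (f b) ^+ 2 <=
    (p * q)%:R * (sumsq (f a) * expR (2 * K * (p * q)%:R * (F b - F a))).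
Proof.
move=> leab K0 h0 majF Df dfK.
apply: le_trans (nm_sqr_le _) _; apply: ler_wpM2l => //.
rewrite -/(sumsq _); set E := expR _.
have E0 : 0 < E by exact: expR_gt0.
apply/ler_addgt0Pr => e e0.
(* Exponentiation multiplies the shift by [E], so the shift e / E contributes exactly e. *)
have e'0 : 0 < e / E by rewrite divr_gt0.
have fa0 : 0 < sumsq (f a) + e / E by rewrite ltr_wpDl // sumsq_ge0.
have fb0 : 0 < sumsq (f b) + e / E by rewrite ltr_wpDl // sumsq_ge0.
have := ac_gronwall_log leab K0 h0 majF Df dfK e'0.
rewrite lerBlDr -ler_expR lnK ?posrE // expRD lnK ?posrE // -/E.
rewrite mulrDr mulrCA mulfV ?gt_eqF // mulr1 [E * _]mulrC.
by apply: le_trans; rewrite lerDl ltW.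
Qed.

End Gronwall.

(** * The Darboux matrix *)

Section NoncommutativeRewriting.
Context (C : comPzRingType).

Lemma scalemxlA p q r (k : C) (A : 'M[C]_(p, q)) (B : 'M[C]_(q, r)) :
  (k *: A) *m B = k *: (A *m B).
Proof. by rewrite scalemxAl. Qed.

Lemma scalemxrA p q r (k : C) (A : 'M[C]_(p, q)) (B : 'M[C]_(q, r)) :
  A *m (k *: B) = k *: (A *m B).
Proof. by rewrite scalemxAr. Qed.

End NoncommutativeRewriting.

Ltac mxexpand := rewrite ?(mulmxDl, mulmxDr, mulmxN, mulNmx, scalemxlA,
  scalemxrA, mulmx1, mul1mx, scalerDr, scalerN, scalerA, opprD, opprK, mulmxA).

(* Every word in the matrices is abstracted before passing to entries. *)
Ltac mxcompare :=
  repeat match goal with |- context [mulmx ?M ?N] => move: (mulmx M N) => ? end;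
  apply/matrixP => ? ?; rewrite ?mxE; ring.

Ltac mxring := mxexpand; mxcompare.

Section DarbouxAlgebra.
Context (C : comNzRingType) (n m : nat) (A D S X Q : 'M[C]_n) (Pi : 'M[C]_(n, m))
  (Ga : 'M[C]_(m, n)) (L : 'M[C]_m) (l : C).
Hypothesis XS : X *m S = 1%:M.
Hypothesis SX : S *m X = 1%:M.
Hypothesis ident : A *m S - S *m D = Pi *m Ga.

(** The identity A S - S D = Pi Ga, multiplied by X on both sides; it removes D from every word in
    which D stands before X. *)
Lemma invmx_intertwining : D *m X = X *m A - X *m Pi *m Ga *m X.
Proof.
have : X *m (A *m S - S *m D) *m X = X *m (Pi *m Ga) *m X by rewrite ident.
rewrite mulmxBr mulmxBl !mulmxA XS mul1mx -[_ *m S *m X]mulmxA SX mulmx1.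
by move=> <-; rewrite opprB addrC subrK.
Qed.

(** The left side is w' by the product rule. For Q = (A - l)^-1 with A' = A^2 and l' = l^2 one has
    Q' = - (1 + l Q)^2 + l^2 Q^2 = - (1 + 2 l Q). *)
Lemma darboux_derivative_algebra :
  A *m Q = 1%:M + l *: Q -> Q *m A = 1%:M + l *: Q ->
  let w := 1%:M - Ga *m X *m Q *m Pi in
  let Y := Ga *m X *m Pi in
  - (((L *m Ga *m D *m X +
       Ga *m - (X *m - (Pi *m L *m Ga + (A *m S + S *m D)) *m X)) *m Q +
      Ga *m X *m - (1%:M + (2 * l) *: Q)) *m Pi +
     Ga *m X *m Q *m - (A *m Pi *m L)) =
  - (L *m Y - Y *m L + Y) *m w + l *: (L *m w - w *m L).
Proof.
move=> AQ QA w Y; rewrite /w /Y.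
(* Expanded words associate to the left, so each relation is needed behind an arbitrary prefix
   [M]. *)
have XSM p (M : 'M[C]_(p, n)) : M *m X *m S = M by rewrite -mulmxA XS mulmx1.
have SXM p (M : 'M[C]_(p, n)) : M *m S *m X = M by rewrite -mulmxA SX mulmx1.
have AQM p (M : 'M[C]_(p, n)) : M *m A *m Q = M + l *: (M *m Q).
  by rewrite -mulmxA AQ mulmxDr mulmx1 scalemxrA.
have QAM p (M : 'M[C]_(p, n)) : M *m Q *m A = M + l *: (M *m Q).
  by rewrite -mulmxA QA mulmxDr mulmx1 scalemxrA.
have DXM p (M : 'M[C]_(p, n)) :
    M *m D *m X = M *m X *m A - M *m X *m Pi *m Ga *m X.
  by rewrite -mulmxA invmx_intertwining mulmxBr !mulmxA.
clear XS SX ident AQ QA.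
mxexpand. rewrite ?(XSM, SXM, DXM, AQM, QAM).
mxexpand. rewrite ?(XSM, SXM, DXM, AQM, QAM).
mxexpand. mxcompare.
Qed.

(** Put X Pi Ga X = X (A - l) - (D - l) X between E = (D - l)^-1 and Q = (A - l)^-1: the result E X
    - X Q cancels the terms linear in E and Q. *)
Lemma darboux_inverse_algebra (E : 'M[C]_n) :
  E *m (D - l%:M) = 1%:M -> (A - l%:M) *m Q = 1%:M ->
  (1%:M + Ga *m E *m X *m Pi) *m (1%:M - Ga *m X *m Q *m Pi) = 1%:M.
Proof.
move=> ED AQ.
have key : E *m X *m Pi *m Ga *m X *m Q = E *m X - X *m Q.
  have -> : E *m X *m Pi *m Ga *m X *m Q = E *m (X *m Pi *m Ga *m X) *m Q by rewrite !mulmxA.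
  have -> : X *m Pi *m Ga *m X = X *m (A - l%:M) - (D - l%:M) *m X.
    rewrite mulmxBr mulmxBl invmx_intertwining scalar_mxC.
    by rewrite opprB addrA addrNK opprB addrC subrK.
  by rewrite mulmxBr mulmxBl !mulmxA ED mul1mx -(mulmxA (E *m X)) AQ mulmx1.
rewrite mulmxBr mulmx1 mulmxDl mul1mx.
have -> : Ga *m E *m X *m Pi *m (Ga *m X *m Q *m Pi) =
    Ga *m (E *m X *m Pi *m Ga *m X *m Q) *m Pi by rewrite !mulmxA.
rewrite key; mxring.
Qed.
End DarbouxAlgebra.

Section QuotientAlgebra.
Context (C : comNzRingType) (m : nat) (l : C).
Implicit Types v w g L p : 'M[C]_m.

(** The gauge term [g] multiplies w1 and w0 alike from the left and so drops out of w1^-1 w0. The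
    summand with factor 0 is the l = 0 case of the Darboux derivative. *)
Lemma quotient_derivative_algebra v1 w1 v0 w0 g L :
  v1 *m w1 = 1%:M -> w1 *m v1 = 1%:M -> w0 *m v0 = 1%:M ->
  - (v1 *m (g *m w1 + l *: (L *m w1 - w1 *m L)) *m v1) *m w0 +
    v1 *m (g *m w0 + 0 *: (L *m w0 - w0 *m L)) =
  l *: (L *m (v1 *m w0) - v1 *m w0 *m (v0 *m L *m w0)).
Proof.
move=> vw wv wv0; rewrite scale0r addr0.
have K1 (M : 'M[C]_m) : M *m w1 *m v1 = M by rewrite -mulmxA wv mulmx1.
have K2 (M : 'M[C]_m) : M *m w0 *m v0 = M by rewrite -mulmxA wv0 mulmx1.
clear wv wv0.
by mxexpand; rewrite ?(K1, K2, vw); mxexpand; rewrite ?(K1, K2, vw); mxcompare.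
Qed.

Lemma transfer_derivative_algebra L p Lt w (pa : 'M[C]_m) :
  (l *: (L *m p - p *m Lt) *m w + p *m (l *: (Lt *m w))) *m pa + p *m w *m 0 =
  l *: (L *m (p *m w *m pa)).
Proof. by rewrite mulmx0 addr0; mxring. Qed.
End QuotientAlgebra.

Section Darboux.
Context (R : realType) (a b : R) (n m : nat).
Context (A D S : R -> 'M[R[i]]_n) (Pi : R -> 'M[R[i]]_(n, m))
  (Ga : R -> 'M[R[i]]_(m, n)) (L : R -> 'M[R[i]]_m).
Hypothesis dA : ac_derive a b A (fun x => A x *m A x).
Hypothesis dD : ac_derive a b D (fun x => D x *m D x).
Hypothesis dPi : ac_derive a b Pi (fun x => - (A x *m Pi x *m L x)).
Hypothesis dGa : ac_derive a b Ga (fun x => L x *m Ga x *m D x).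
Hypothesis dS : ac_derive a b S
  (fun x => - (Pi x *m L x *m Ga x + (A x *m S x + S x *m D x))).
Hypothesis S_unit : forall x, x \in `[a, b] -> S x \in unitmx.
Hypothesis id_a : A a *m S a - S a *m D a = Pi a *m Ga a.

(** Both sides have the derivative Pi L Ga D - A Pi L Ga, so their difference keeps its value 0 from
    a. *)
Lemma darboux_identity x : x \in `[a, b] ->
  A x *m S x - S x *m D x = Pi x *m Ga x.
Proof.
move=> xab; apply/eqP; rewrite -subr_eq0; apply/eqP.
pose E x := A x *m S x - S x *m D x - Pi x *m Ga x.
rewrite -[LHS]/(E x) (_ : E x = E a); first by rewrite /E id_a subrr.
apply: (ac_derive0_const _ xab).
have := ac_deriveB (ac_deriveB (ac_deriveM dA dS) (ac_deriveM dS dD)) (ac_deriveM dPi dGa).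
apply: ac_derive_eq; apply: ae_all => t _; apply/eqP; rewrite subr_eq0; apply/eqP.
by mxring.
Qed.

Definition darboux (Q : R -> 'M[R[i]]_n) x :=
  1%:M - Ga x *m invmx (S x) *m Q x *m Pi x.

(** The term q of the overview. Neither [Q] nor [l] occurs in it, hence the cancellation in
    quotients. *)
Definition darboux_gauge x :=
  let Y := Ga x *m invmx (S x) *m Pi x in - (L x *m Y - Y *m L x + Y).

(* [Q] plays the role of the resolvent [(A - l)^-1]. *)
Definition multiplier (l : R -> R[i]) (Q E : R -> 'M[R[i]]_n) :=
  [/\ ac_derive a b Q (fun x => - (1%:M + (2 * l x) *: Q x)),
      forall x, x \in `[a, b] -> A x *m Q x = 1%:M + l x *: Q x,
      forall x, x \in `[a, b] -> Q x *m A x = 1%:M + l x *: Q x &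
      forall x, x \in `[a, b] -> E x *m (D x - (l x)%:M) = 1%:M].

Lemma ac_derive_darboux l Q E : multiplier l Q E ->
  ac_derive a b (darboux Q)
  (fun x => darboux_gauge x *m darboux Q x +
            l x *: (L x *m darboux Q x - darboux Q x *m L x)).
Proof.
move=> [dQ AQ QA _].
have := ac_deriveB (ac_derive_cst a b (1%:M : 'M[R[i]]_m))
  (ac_deriveM (ac_deriveM (ac_deriveM dGa (ac_derive_inv S_unit dS)) dQ) dPi).
apply: ac_derive_eq; apply: ae_all => x xab; rewrite sub0r.
have := darboux_derivative_algebra (L x) (mulVmx (S_unit xab)) (mulmxV (S_unit xab))
  (darboux_identity xab) (AQ x xab) (QA x xab).
exact.
Qed.

Lemma darboux_mulV l Q E x : multiplier l Q E -> x \in `[a, b] ->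
  (1%:M + Ga x *m E x *m invmx (S x) *m Pi x) *m darboux Q x = 1%:M.
Proof.
move=> [_ AQ _ ED] xab.
apply: (darboux_inverse_algebra (mulVmx (S_unit xab)) (mulmxV (S_unit xab))
  (darboux_identity xab) (ED x xab)).
by rewrite mulmxBl AQ // mul_scalar_mx addrK.
Qed.

Lemma darboux_unit l Q E x : multiplier l Q E -> x \in `[a, b] ->
  darboux Q x \in unitmx.
Proof. by move=> mQ /(darboux_mulV mQ) /mulmx1_unit []. Qed.

Lemma invmx_darboux l Q E x : multiplier l Q E -> x \in `[a, b] ->
  invmx (darboux Q x) = 1%:M + Ga x *m E x *m invmx (S x) *m Pi x.
Proof.
move=> mQ xab; have /(congr1 (mulmxr (invmx (darboux Q x)))) := darboux_mulV mQ xab.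
by rewrite /= mul1mx mulmxK // (darboux_unit mQ xab).
Qed.

Section Transfer.
Context (l : R -> R[i]) (Q E Q0 E0 : R -> 'M[R[i]]_n).
Hypothesis mQ : multiplier l Q E.
Hypothesis mQ0 : multiplier (fun=> 0) Q0 E0.

Definition darboux_quotient x := invmx (darboux Q x) *m darboux Q0 x.

(** The given [w] solves the transformed system and the constructed [u] the original one: u = p w
    p(a)^-1 with p = w_Q^-1 w_Q0, where the constant last factor normalises u at a. *)
Lemma darboux_transfer (w : R -> 'M[R[i]]_m) : a <= b ->
  w a = 1%:M ->
  ac_derive a b w
    (fun x => l x *: (invmx (darboux Q0 x) *m L x *m darboux Q0 x *m w x)) ->
  exists u, [/\ u a = 1%:M, ac_derive a b u (fun x => l x *: (L x *m u x)) &
    w b = invmx (darboux Q0 b) *m darboux Q b *m u b *m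
          (invmx (darboux Q a) *m darboux Q0 a)].
Proof.
move=> leab wa dw.
have ain : a \in `[a, b] by rewrite in_itv /= lexx.
have bin : b \in `[a, b] by rewrite in_itv /= lexx leab.
have uQ x (xab : x \in `[a, b]) := darboux_unit mQ xab.
have uQ0 x (xab : x \in `[a, b]) := darboux_unit mQ0 xab.
pose p := darboux_quotient.
have up x : x \in `[a, b] -> p x \in unitmx.
  by move=> xab; rewrite /p /darboux_quotient unitmx_mul unitmx_inv uQ ?uQ0.
have dp : ac_derive a b p (fun x => l x *: (L x *m p x -
    p x *m (invmx (darboux Q0 x) *m L x *m darboux Q0 x))).
  have := ac_deriveM (ac_derive_inv uQ (ac_derive_darboux mQ)) (ac_derive_darboux mQ0).
  apply: ac_derive_eq; apply: ae_all => x xab.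
  exact: (quotient_derivative_algebra (l x) (darboux_gauge x) (L x)
    (mulVmx (uQ x xab)) (mulmxV (uQ x xab)) (mulmxV (uQ0 x xab))).
have du := ac_deriveM (ac_deriveM dp dw) (ac_derive_cst a b (invmx (p a))).
exists (fun x => p x *m w x *m invmx (p a)); split.
- by rewrite wa mulmx1 mulmxV // up.
- apply: ac_derive_eq du; apply: ae_all => x xab.
  exact: transfer_derivative_algebra.
- cbv beta.
  have -> : invmx (darboux Q0 b) *m darboux Q b = invmx (p b).
    rewrite /p /darboux_quotient; apply: (can_inj (mulKmx (up b bin))).
    rewrite mulmxV ?up // mulmxA -[_ *m _ *m invmx (darboux Q0 b)]mulmxA mulmxV ?uQ0 //.
    by rewrite mulmx1 mulVmx ?uQ.
  by rewrite -[invmx (darboux Q a) *m _]/(p a) -(mulmxA (p b)) mulKmx ?up // mulmxKV ?up.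
Qed.
End Transfer.
End Darboux.

(** * Resolvent bounds *)

Section Resolvent.
Context (R : realType).
Local Notation normc := (@ComplexField.Normc.normc R).

Lemma nmM_le p q r (A : 'M[R[i]]_(p, q)) (B : 'M[R[i]]_(q, r)) (k l : R) :
  nm A <= k -> nm B <= l -> nm (A *m B) <= k * l.
Proof.
by move=> Ak Bl; apply: le_trans (nmM _ _) _; apply: ler_pM => //; exact: nm_ge0.
Qed.

Lemma nmD_le p q (A B : 'M[R[i]]_(p, q)) (k l : R) :
  nm A <= k -> nm B <= l -> nm (A + B) <= k + l.
Proof. by move=> Ak Bl; apply: le_trans (nmD _ _) _; exact: lerD. Qed.

Lemma unitmx_eigenvalue (F : fieldType) n (B : 'M[F]_n) (z : F) :
  (B - z%:M \in unitmx) = ~~ eigenvalue B z.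
Proof. by rewrite /eigenvalue negbK /eigenspace kermx_eq0 row_free_unit. Qed.

Lemma unitmxN n (B : 'M[R[i]]_n) : (- B \in unitmx) = (B \in unitmx).
Proof. by rewrite -scaleN1r unitmxZ // unitrN1. Qed.

(* Newton expansion: each root [mu] gives
   [R P = (z - mu)^-1 (P + R (B - mu) P)] for the resolvent [R] at [z]. *)
Lemma resolvent_newton n (B : 'M[R[i]]_n.+1) (d : R) (s : seq R[i])
    (P : 'M[R[i]]_n.+1) :
  0 < d -> exists2 C : R, 0 <= C & forall z,
    B - z%:M \in unitmx -> (forall mu, mu \in s -> d <= normc (z - mu)) ->
    nm (invmx (z%:M - B) *m P) <= C + C *
      nm (invmx (z%:M - B) *m (horner_mx B (\prod_(mu <- s) ('X - mu%:P)) *m P)).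
Proof.
move=> d0; elim: s P => [|mu s IH] P.
  exists 1 => // z _ _; rewrite big_nil rmorph1 mul1mx mul1r lerDr ler01 //.
have [C C0 HC] := IH ((B - mu%:M) *m P).
exists (d^-1 * (nm P + C)) => [|z uz dz].
  by rewrite mulr_ge0 ?invr_ge0 ?(ltW d0) // addr_ge0 // nm_ge0.
have uz' : z%:M - B \in unitmx by rewrite -opprB unitmxN.
set V := invmx _; have VB : V *m (z%:M - B) = 1%:M by rewrite mulVmx.
have dmu : d <= normc (z - mu) by apply: dz; rewrite inE eqxx.
have zmu0 : z - mu != 0.
  apply/eqP => E; move: dmu; rewrite E ComplexField.Normc.normc0.
  by rewrite leNgt d0.
have E1 : V *m P = (z - mu)^-1 *: (P + V *m ((B - mu%:M) *m P)).
  apply: (canRL (scalerK zmu0)).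
  rewrite -[X in _ = X + _](mul1mx P) -VB -mulmxA -mulmxDr -mulmxDl.
  rewrite addrA subrK -raddfB /= mul_scalar_mx scalemxrA //.
have {HC}H1 := HC z uz (fun nu hnu => dz nu (@mem_behead _ (mu :: s) _ hnu)).
rewrite E1 nmZ ComplexField.Normc.normcV big_cons rmorphM /=.
have -> : horner_mx B ('X - mu%:P) * horner_mx B (\prod_(j <- s) ('X - j%:P)) *m P =
    horner_mx B (\prod_(j <- s) ('X - j%:P)) *m ((B - mu%:M) *m P).
  rewrite -rmorphM mulrC rmorphM /= rmorphB /= horner_mx_X horner_mx_C.
  by rewrite -mulmxE mulmxA.
set T := nm _ in H1 *; set T2 := nm (V *m (horner_mx _ _ *m _)) in H1 *.
have T20 : 0 <= T2 by exact: nm_ge0.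
apply: (@le_trans _ _ (d^-1 * (nm P + (C + C * T2)))).
  apply: ler_pM; rewrite ?invr_ge0 ?normc_ge0 ?nm_ge0 //.
    by rewrite lef_pV2 ?posrE // (lt_le_trans d0 dmu).
  by apply: nmD_le.
rewrite -mulrA -mulrDr; apply: ler_wpM2l; first by rewrite invr_ge0 ltW.
by rewrite addrA lerD2l mulrDl lerDr mulr_ge0 // nm_ge0.
Qed.

(** Take for [s] the roots of the characteristic polynomial with multiplicity. Cayley-Hamilton
    annihilates the last term of the Newton expansion of P = 1, which leaves a constant independent
    of z. *)
Lemma resolvent_bounded n (B : 'M[R[i]]_n.+1) : exists s : seq R[i],
  (forall z, (z \in s) = eigenvalue B z) /\
  forall d : R, 0 < d -> exists2 C : R, 0 <= C & forall z,
    (forall mu, mu \in s -> d <= normc (z - mu)) -> nm (invmx (z%:M - B)) <= C.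
Proof.
have [s charB] := closed_field_poly_normal (char_poly B).
rewrite (monicP (char_poly_monic B)) scale1r in charB.
have sE z : (z \in s) = eigenvalue B z.
  by rewrite eigenvalue_root_char charB root_prod_XsubC.
exists s; split => // d d0; have [C C0 HC] := resolvent_newton B s 1%:M d0.
exists C => // z dz.
have zs : z \notin s.
  apply/negP => /dz; rewrite subrr ComplexField.Normc.normc0.
  by rewrite leNgt d0.
have uz : B - z%:M \in unitmx by rewrite unitmx_eigenvalue -sE.
have := HC z uz dz; rewrite -charB.
have -> : horner_mx B (char_poly B) = 0 by exact: Cayley_Hamilton.
rewrite mul0mx mulmx0 mulmx1.
suff -> : nm (0 : 'M[R[i]]_n.+1) = 0 by rewrite mulr0 addr0.
by rewrite /nm big1 // => i _; rewrite big1 // => j _; rewrite mxE ComplexField.Normc.normc0.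
Qed.

(** For each mu the squared distance to t is absolutely continuous in t and has no zero on [a, b],
    so [ac_nonzero] applies. *)
Lemma dist_segment_gt0 (a b : R) (s : seq R[i]) :
  (forall mu, mu \in s -> forall t, t \in `[a, b] -> mu != t%:C) ->
  exists2 d : R, 0 < d & forall mu, mu \in s -> forall t, t \in `[a, b] ->
    d <= normc (mu - t%:C).
Proof.
elim: s => [|mu s IH] Hs; first by exists 1.
have [|d d0 Hd] := IH; first by move=> nu nus; apply: Hs; rewrite inE nus orbT.
have sq t : normc (mu - t%:C) ^+ 2 =
    (complex.Re mu - t) * (complex.Re mu - t) + complex.Im mu ^+ 2.
  by rewrite sqr_normc_ReIm -expr2; case: (mu) => x y /=; rewrite subr0.
have acf : abs_continuous a b
    (fun t => (complex.Re mu - t) * (complex.Re mu - t) + complex.Im mu ^+ 2).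
  have ac1 : abs_continuous a b (fun t => complex.Re mu - t).
    by apply: acD; [exact: ac_cst | apply: acN; exact: ac_id].
  by apply: acD; [exact: acM | exact: ac_cst].
have mut t : a <= t -> t <= b ->
    (complex.Re mu - t) * (complex.Re mu - t) + complex.Im mu ^+ 2 != 0.
  move=> at_ tb; rewrite -sq sqrf_eq0; apply/eqP => /ComplexField.Normc.eq0_normc /eqP.
  have tab : t \in `[a, b] by rewrite in_itv /= at_ tb.
  by rewrite subr_eq0 (negbTE (Hs mu (mem_head _ _) t tab)).
have [e e0 He] := ac_nonzero acf mut.
exists (Num.min d (Num.sqrt e)) => [|nu]; first by rewrite lt_min d0 sqrtr_gt0.
rewrite inE => /orP[/eqP ->|nus] t tab; rewrite ge_min; last by rewrite (Hd _ nus t tab).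
apply/orP; right; rewrite -(@ler_pXn2r _ 2) ?nnegrE ?sqrtr_ge0 ?normc_ge0 //.
rewrite sqr_sqrtr ?(ltW e0) // sq; move: tab; rewrite in_itv /= => /andP[at_ tb].
by rewrite -[X in _ <= X]ger0_norm ?He // -sq sqr_ge0.
Qed.
End Resolvent.

(** * Multiplicative integrals *)

Section Adjoint.
Context (R : realType).

Lemma adjM p q r (A : 'M[R[i]]_(p, q)) (B : 'M[R[i]]_(q, r)) :
  (A *m B)^t* = B^t* *m A^t*.
Proof. by rewrite trmx_mul map_mxM. Qed.

Lemma adjZ p q c (A : 'M[R[i]]_(p, q)) : (c *: A)^t* = Num.conj c *: A^t*.
Proof. by apply/matrixP => i j; rewrite !mxE rmorphM. Qed.

Lemma adjK p q (A : 'M[R[i]]_(p, q)) : A^t*^t* = A.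
Proof. by apply/matrixP => i j; rewrite !mxE conjCK. Qed.

Lemma adjD p q (A B : 'M[R[i]]_(p, q)) : (A + B)^t* = A^t* + B^t*.
Proof. by apply/matrixP => i j; rewrite !mxE rmorphD. Qed.

Lemma adjN p q (A : 'M[R[i]]_(p, q)) : (- A)^t* = - A^t*.
Proof. by apply/matrixP => i j; rewrite !mxE rmorphN. Qed.

Lemma adj_scalar n (c : R[i]) : (c%:M : 'M[R[i]]_n)^t* = (Num.conj c)%:M.
Proof. by rewrite tr_scalar_mx map_scalar_mx. Qed.

Lemma adj_inv n (A : 'M[R[i]]_n) : (invmx A)^t* = invmx (A^t*).
Proof. by rewrite trmx_inv map_invmx. Qed.

Lemma conj_real (x : R) : Num.conj (x%:C) = x%:C :> R[i].
Proof. by rewrite conj_complexE /= oppr0. Qed.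

Lemma mulii : 'i * 'i = -1 :> R[i].
Proof. by rewrite -expr2 sqrCi. Qed.

Lemma normc_i : ComplexField.Normc.normc ('i : R[i]) = 1.
Proof. by have := @normCi R[i]; rewrite norm_normc => /(congr1 (@complex.Re R)). Qed.
End Adjoint.

Section Multint.
Context (R : realType) (m : nat) (J : 'M[R[i]]_m) (a b : R).
Hypothesis leab : a <= b.
Implicit Types (H : R -> 'M[R[i]]_m) (z : R[i]) (h F : R -> R).
Local Notation normc := (@ComplexField.Normc.normc R).

Lemma nm_generator_le H h (k d : R) z x (w : 'M[R[i]]_m) :
  0 <= k -> nm (H x) <= k * h x -> 0 < d -> d <= normc (z - x%:C) ->
  nm (('i / (z - x%:C)) *: (J *m H x *m w)) <= d^-1 * nm J * k * h x * nm w.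
Proof.
move=> k0 Hh d0 dz; rewrite nmZ ComplexField.Normc.normcM normc_i mul1r.
rewrite ComplexField.Normc.normcV -!mulrA.
apply: ler_pM; rewrite ?invr_ge0 ?normc_ge0 ?nm_ge0 //.
  by rewrite lef_pV2 ?posrE // (lt_le_trans d0 dz).
rewrite !mulrA -(mulrA (nm J)); do 2 apply: nmM_le => //.
Qed.

(** The difference of two fundamental solutions vanishes at a, and |z - x| >= |Im z| bounds the
    generator, so Gronwall's bound at b is 0. *)
Lemma multint_unique H F h z w :
  majorizes a b F h -> (forall x, nm (H x) <= h x) -> complex.Im z != 0 ->
  is_fundamental_solution J H a b z w -> multint J H a b z = w b.
Proof.
move=> majF Hh imz fw; rewrite /multint.
case: xgetP => [_ -> [w' [w'a dw'] ->]|/(_ (w b))]; last by case; exists w.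
have [wa dw] := fw.
apply/eqP; rewrite -subr_eq0; apply/eqP; apply: nm_eq0.
have df := ac_deriveB dw' dw.
have h0 x : 0 <= h x by apply: le_trans (Hh x); exact: nm_ge0.
have dz x : `|complex.Im z| <= normc (z - x%:C).
  apply: le_trans (Im_le_normc _); by rewrite ImD /= oppr0 addr0.
have K0 : 0 <= `|complex.Im z|^-1 * nm J * 1.
  by rewrite !mulr_ge0 ?invr_ge0 ?nm_ge0.
have df2 : {ae lebesgue_measure, forall x : R, x \in `[a, b] ->
    nm (('i / (z - x%:C)) *: (J *m H x *m w' x) -
        ('i / (z - x%:C)) *: (J *m H x *m w x)) <=
    `|complex.Im z|^-1 * nm J * 1 * h x * nm (w' x - w x)}.
  apply: ae_all => x xab; rewrite -scalerBr -mulmxBr.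
  by apply: nm_generator_le; rewrite ?mul1r ?normr_gt0.
have := ac_gronwall leab K0 h0 majF df df2.
rewrite wa w'a subrr (_ : sumsq 0 = 0); last first.
  by apply: big1 => i _; apply: big1 => j _; rewrite mxE ComplexField.Normc.normc0 expr0n.
rewrite mul0r mulr0 => le0; apply/eqP; rewrite -sqrf_eq0 eq_le le0.
exact: sqr_ge0.
Qed.

(** The second case is the default of [xget], which is harmless for boundedness. *)
Lemma multint_spec H z :
  (exists2 w, is_fundamental_solution J H a b z w & multint J H a b z = w b) \/
  multint J H a b z = 0.
Proof. by rewrite /multint; case: xgetP => [_ -> [w fw ->]|]; [left; exists w|right]. Qed.

(** The constant depends on z only through [d]. The factor [k] lets the transformed Hamiltonian use
    the majorant of the original one. *)
Lemma fundamental_bounded H F h (k d : R) :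
  majorizes a b F h -> (forall x, 0 <= h x) -> 0 <= k ->
  (forall x, x \in `[a, b] -> nm (H x) <= k * h x) -> 0 < d ->
  exists C : R, forall z w, (forall x, x \in `[a, b] -> d <= normc (z - x%:C)) ->
    is_fundamental_solution J H a b z w -> nm (w b) <= C.
Proof.
move=> majF h0 k0 Hh d0.
have K0 : 0 <= d^-1 * nm J * k.
  by rewrite !mulr_ge0 ?invr_ge0 ?nm_ge0 // ltW.
set C := (m * m)%:R * (sumsq (1%:M : 'M[R[i]]_m) *
  expR (2 * (d^-1 * nm J * k) * (m * m)%:R * (F b - F a))).
exists (1 + C) => z w dz [wa dw].
have dw2 : {ae lebesgue_measure, forall x : R, x \in `[a, b] ->
    nm (('i / (z - x%:C)) *: (J *m H x *m w x)) <=
    d^-1 * nm J * k * h x * nm (w x)}.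
  by apply: ae_all => x xab; apply: nm_generator_le => //; [exact: Hh | exact: dz].
have := ac_gronwall leab K0 h0 majF dw dw2; rewrite wa -/C.
(* From y^2 <= C and (y - 1)^2 >= 0 follows y <= 1 + C. *)
have := nm_ge0 (w b); have := sqr_ge0 (nm (w b) - 1); rewrite sqrrB; nra.
Qed.
End Multint.

(** * The multipliers built from the resolvent of B *)

Section ResolventMultiplier.
Context (R : realType) (a b : R) (n : nat) (B : 'M[R[i]]_n).
Hypothesis B_spec : forall x : R, x \in `[a, b] -> ~~ eigenvalue B x%:C.
Let A x := invmx (B - x%:C%:M).

Lemma shift_unit (x : R) : x \in `[a, b] -> B - x%:C%:M \in unitmx.
Proof. by move=> xab; rewrite unitmx_eigenvalue B_spec. Qed.

Lemma ac_derive_shift :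
  ac_derive a b (fun x : R => B - x%:C%:M) (fun=> 0 - 1%:M).
Proof. by apply: ac_deriveB; [exact: ac_derive_cst | exact: ac_derive_id]. Qed.

Lemma ac_derive_resolvent : ac_derive a b A (fun x => A x *m A x).
Proof.
apply: ac_derive_eq (ac_derive_inv shift_unit ac_derive_shift).
by apply: ae_all => x _; rewrite sub0r mulmxN mulNmx opprK mulmx1.
Qed.

Lemma ac_derive_resolvent_adj :
  ac_derive a b (fun x => (A x)^t*) (fun x => (A x)^t* *m (A x)^t*).
Proof.
apply: ac_derive_eq (ac_derive_adj ac_derive_resolvent).
by apply: ae_all => x _; rewrite adjM.
Qed.

Lemma multiplier_zero : multiplier a b A (fun x => (A x)^t*) (fun=> 0)
  (fun x : R => B - x%:C%:M) (fun x : R => (B - x%:C%:M)^t*).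
Proof.
split=> [|x xab|x xab|x xab]; rewrite ?scale0r ?addr0.
- apply: ac_derive_eq ac_derive_shift; apply: ae_all => x _.
  by rewrite mulr0 scale0r addr0 sub0r.
- by rewrite mulVmx // shift_unit.
- by rewrite mulmxV // shift_unit.
- by rewrite raddf0 subr0 -adjM mulVmx ?shift_unit // adj_scalar rmorph1.
Qed.

(** This is (A - l)^-1, since (B - x)^-1 - (z - x)^-1 = (z - B) (B - x)^-1 (z - x)^-1. It stays
    regular as z approaches x, although l blows up there. *)
Definition resolvent_multiplier (z : R[i]) (x : R) :=
  (z%:M - x%:C%:M) *m invmx (z%:M - B) *m (B - x%:C%:M).

Lemma resolvent_shift (z : R[i]) (x : R) : z%:M - B \in unitmx ->
  (z%:M - x%:C%:M) *m invmx (z%:M - B) = 1%:M + (B - x%:C%:M) *m invmx (z%:M - B) /\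
  (z%:M - x%:C%:M) *m invmx (z%:M - B) = 1%:M + invmx (z%:M - B) *m (B - x%:C%:M).
Proof.
move=> uz; have zx : z%:M - x%:C%:M = (z%:M - B) + (B - x%:C%:M) :> 'M[R[i]]_n.
  by rewrite addrA subrK.
split; first by rewrite zx mulmxDl mulmxV.
by rewrite -raddfB /= -scalar_mxC raddfB /= zx mulmxDr mulVmx.
Qed.

(** Here z occurs only inside the resolvent, so a resolvent bound gives a bound uniform in z. *)
Lemma resolvent_multiplierE (z : R[i]) (x : R) : z%:M - B \in unitmx ->
  resolvent_multiplier z x =
  (B - x%:C%:M) + invmx (z%:M - B) *m (B - x%:C%:M) *m (B - x%:C%:M).
Proof.
move=> uz; rewrite /resolvent_multiplier (resolvent_shift x uz).2.
by rewrite mulmxDl mul1mx.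
Qed.

Lemma scale_resolvent_multiplier (z : R[i]) (x : R) : z - x%:C != 0 ->
  (z - x%:C)^-1 *: resolvent_multiplier z x = invmx (z%:M - B) *m (B - x%:C%:M).
Proof.
move=> zx; rewrite /resolvent_multiplier -raddfB /= mul_scalar_mx -scalemxAl scalerA.
by rewrite mulVf // scale1r.
Qed.

Lemma resolvent_multiplier_left (z : R[i]) (x : R) : z%:M - B \in unitmx ->
  z - x%:C != 0 -> x \in `[a, b] ->
  A x *m resolvent_multiplier z x =
  1%:M + (z - x%:C)^-1 *: resolvent_multiplier z x.
Proof.
move=> uz zx xab; rewrite scale_resolvent_multiplier //.
have [sl sr] := resolvent_shift x uz; rewrite -sr.
rewrite /resolvent_multiplier -[in RHS](mul1mx (_ *m _)) -(mulVmx (shift_unit xab)) -/(A x).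
rewrite -[RHS]mulmxA; congr (_ *m _).
have comm : (B - x%:C%:M) *m invmx (z%:M - B) = invmx (z%:M - B) *m (B - x%:C%:M).
  by apply: (addrI 1%:M); rewrite -sl -sr.
rewrite -raddfB /= !mul_scalar_mx -scalemxAl -scalemxAr; congr (_ *: _).
by rewrite comm.
Qed.

(** Since D = A^* and l at the conjugate of z is the conjugate of l, the adjoint of A Q = 1 + l Q at
    [Num.conj z] is the left-inverse relation for D - l. Hence both z and its conjugate must avoid
    the spectrum. *)
Lemma multiplier_resolvent (z : R[i]) :
  z%:M - B \in unitmx -> (Num.conj z)%:M - B \in unitmx ->
  (forall x : R, x \in `[a, b] -> z - x%:C != 0) ->
  multiplier a b A (fun x => (A x)^t*) (fun x : R => (z - x%:C)^-1)
    (resolvent_multiplier z) (fun x => (resolvent_multiplier (Num.conj z) x)^t*).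
Proof.
move=> uz uzc zx; split=> [|x xab|x xab|x xab].
- have dz := ac_deriveB (ac_derive_cst a b (z%:M : 'M[R[i]]_n)) (ac_derive_id a b n).
  have := ac_deriveM (ac_deriveM dz (ac_derive_cst a b (invmx (z%:M - B)))) ac_derive_shift.
  apply: ac_derive_eq; apply: ae_all => x xab.
  rewrite -scalerA scale_resolvent_multiplier ?zx // mulmx0 addr0 !sub0r.
  rewrite mulNmx mul1mx mulNmx mulmxN mulmx1 (resolvent_shift x uz).2.
  by rewrite scaler_nat mulr2n -opprD [_ + (1%:M + _)]addrC -addrA.
- exact: resolvent_multiplier_left (zx x xab) xab.
- rewrite scale_resolvent_multiplier ?zx // /resolvent_multiplier -mulmxA.
  by rewrite mulmxV ?shift_unit // mulmx1 (resolvent_shift x uz).2.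
- have zxc : Num.conj z - x%:C != 0.
    by rewrite -(conj_real x) -rmorphB conjC_eq0 zx.
  have := resolvent_multiplier_left uzc zxc xab.
  move/(congr1 (fun M : 'M[R[i]]_n => M^t*)); rewrite adjM adjD adjZ adj_scalar rmorph1.
  rewrite fmorphV rmorphB /= conjCK conj_real => E.
  by rewrite mulmxBr E mul_mx_scalar addrK.
Qed.
End ResolventMultiplier.

Lemma resolvent_bounded_off_spectrum (R : realType) n (B : 'M[R[i]]_n) :
  exists s : seq R[i], (forall z, (z \in s) = eigenvalue B z) /\
  forall d : R, 0 < d -> exists2 C : R, 0 <= C & forall z,
    (forall mu, mu \in s -> d <= ComplexField.Normc.normc (z - mu)) ->
    nm (invmx (z%:M - B)) <= C.
Proof.
case: n B => [|n] B; last exact: resolvent_bounded.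
exists [::]; split=> [z|d d0].
  by apply/esym/negbTE; rewrite -unitmx_eigenvalue unitmxE det_mx00 unitr1.
by exists 0 => // z _; rewrite /nm big_ord0.
Qed.

(** * The transformed canonical system *)

Section TransformedSystem.
Context (R : realType) (m n : nat) (a b : R) (leab : a <= b).
Context (J : 'M[R[i]]_m) (J_herm : J = J^t*) (JJ : J *m J = 1%:M).
Context (H : R -> 'M[R[i]]_m) (H_int : mx_integrable a b H).
Hypothesis H_herm :
  {ae lebesgue_measure, forall x : R, x \in `[a, b] -> H x = (H x)^t*}.
Context (B : 'M[R[i]]_n).
Hypothesis B_spec : forall x : R, x \in `[a, b] -> ~~ eigenvalue B x%:C.
Context (Pi : R -> 'M[R[i]]_(n, m)) (S : R -> 'M[R[i]]_n).
Let A x := invmx (B - x%:C%:M).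
Hypothesis Sa_herm : S a = (S a)^t*.
Hypothesis id_a : A a *m S a - S a *m (A a)^t* = 'i *: (Pi a *m J *m (Pi a)^t*).
Hypothesis dPi : ac_derive a b Pi (fun x => - 'i *: (A x *m Pi x *m J *m H x)).
Hypothesis dS : ac_derive a b S (fun x =>
  Pi x *m J *m H x *m J^t* *m (Pi x)^t* - (A x *m S x + S x *m (A x)^t*)).
Hypothesis S_unit : forall x : R, x \in `[a, b] -> S x \in unitmx.

Let Ga x := 'i *: (J *m (Pi x)^t*).
Let L x := 'i *: (J *m H x).
Let D x := (A x)^t*.
Let Q0 (x : R) := B - x%:C%:M.
Local Notation normc := (@ComplexField.Normc.normc R).
Local Notation w_ Q := (darboux S Pi Ga Q).

Let dA := ac_derive_resolvent B_spec.
Let dD := ac_derive_resolvent_adj B_spec.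

Let dPi' : ac_derive a b Pi (fun x => - (A x *m Pi x *m L x)).
Proof.
apply: ac_derive_eq dPi; apply: ae_all => x _.
by rewrite /L -scalemxAr scaleNr !mulmxA.
Qed.

Let dGa : ac_derive a b Ga (fun x => L x *m Ga x *m D x).
Proof.
have := ac_deriveZ 'i (ac_deriveM (ac_derive_cst a b J) (ac_derive_adj dPi)).
apply: ac_derive_eq; apply: ae_imply H_herm => x Hx xab.
rewrite mul0mx add0r adjZ rmorphN /= conjCi opprK !adjM -(Hx xab) -J_herm.
by rewrite /L /Ga /D -!scalemxAl -!scalemxAr -scalemxAl !mulmxA.
Qed.

Let dS' : ac_derive a b S
  (fun x => - (Pi x *m L x *m Ga x + (A x *m S x + S x *m D x))).
Proof.
apply: ac_derive_eq dS; apply: ae_all => x _.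
rewrite /L /Ga /D -J_herm -!scalemxAr -!scalemxAl scalerA mulii scaleN1r [in RHS]opprD opprK.
by rewrite !mulmxA.
Qed.

Let id_a' : A a *m S a - S a *m D a = Pi a *m Ga a.
Proof. by rewrite /D id_a /Ga -scalemxAr mulmxA. Qed.

(** T = S - S^* solves T' = - (A T + T D), so A T D is constant by A' = A^2 and D' = D^2. It
    vanishes at a, and A and D are invertible. *)
Lemma S_herm x : x \in `[a, b] -> S x = (S x)^t*.
Proof.
move=> xab; pose K x := A x *m (S x - (S x)^t*) *m D x.
have dK : ac_derive a b K (fun=> 0).
  have := ac_deriveM (ac_deriveM dA (ac_deriveB dS (ac_derive_adj dS))) dD.
  apply: ac_derive_eq; apply: ae_imply H_herm => t Ht tab.
  rewrite !(adjD, adjN, adjM, adjK) -(Ht tab) -J_herm -/(D t) -/(A t) /D.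
  rewrite !mulmxA; set P := _ *m _ *m _ *m _ *m (Pi t)^t*.
  set T := (S t)^t*; set E := (A t)^t*.
  by move: P T E (A t) (S t) => P T E A' S'; mxring.
have K0 : K x = 0 by rewrite (ac_derive0_const dK xab) /K -Sa_herm subrr mulmx0 mul0mx.
have uA : A x \in unitmx by rewrite unitmx_inv (shift_unit B_spec xab).
have uD : D x \in unitmx by rewrite /D map_unitmx unitmx_tr.
apply/eqP; rewrite -subr_eq0; apply/eqP.
by rewrite -(mulKmx uA (S x - _)) -(mulmxK uD (A x *m _)) -/(K x) K0 mul0mx mulmx0.
Qed.

Let mQ0 := multiplier_zero B_spec.
Let mulV0 x (xab : x \in `[a, b]) :=
  invmx_darboux dA dD dPi' dGa dS' S_unit id_a' mQ0 xab.

(** The explicit inverse at l = 0 has E = (B - x)^*; with S Hermitian it is term by term the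
    J-adjoint of w0. *)
Lemma darboux0_J_unitary x : x \in `[a, b] ->
  invmx (w_ Q0 x) = J *m (w_ Q0 x)^t* *m J.
Proof.
move=> xab; rewrite mulV0 // /darboux [in RHS]adjD [in RHS]adjN !adjM adj_scalar conjC1 adj_inv.
rewrite -(S_herm xab) /Ga adjZ conjCi adjM adjK -J_herm.
rewrite mulmxDr mulmxDl mulmx1 JJ mulmxN mulNmx.
rewrite -!scalemxAr -!scalemxAl scaleNr opprK; congr (_ + _ *: _).
by rewrite -!mulmxA JJ mulmx1.
Qed.

Lemma transformed_generator x (w : 'M[R[i]]_m) : x \in `[a, b] ->
  'i *: (J *m ((w_ Q0 x)^t* *m H x *m w_ Q0 x) *m w) =
  invmx (w_ Q0 x) *m L x *m w_ Q0 x *m w.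
Proof.
move=> xab; rewrite darboux0_J_unitary // /L -scalemxAr -!scalemxAl; congr (_ *: _).
by rewrite -(mulmxA _ J) (mulmxA J J) JJ mul1mx !mulmxA.
Qed.

Let Ht x := (w_ Q0 x)^t* *m H x *m w_ Q0 x.

Lemma transformed_multint z wt : complex.Im z != 0 ->
  z%:M - B \in unitmx -> (Num.conj z)%:M - B \in unitmx ->
  is_fundamental_solution J Ht a b z wt ->
  wt b = invmx (w_ Q0 b) *m w_ (resolvent_multiplier B z) b *m multint J H a b z *m
    (invmx (w_ (resolvent_multiplier B z) a) *m w_ Q0 a).
Proof.
move=> imz uz uzc [wta dwt].
have zx (x : R) : x \in `[a, b] -> z - x%:C != 0.
  move=> _; apply/eqP => /(congr1 (@complex.Im R)).
  by rewrite ImD /= oppr0 addr0; apply/eqP.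
have mQ := multiplier_resolvent B_spec uz uzc zx.
have [|u [ua du ->]] := darboux_transfer dA dD dPi' dGa dS' S_unit id_a' mQ mQ0 leab wta.
  apply: ac_derive_eq dwt; apply: ae_all => x xab.
  by rewrite -transformed_generator // scalerA [_ * 'i]mulrC.
have [F [h [majF Hh]]] := mx_integrable_majorant H_int.
have fu : is_fundamental_solution J H a b z u.
  split; first exact: ua.
  apply: ac_derive_eq du; apply: ae_all => x _.
  by rewrite /L -scalemxAl scalerA mulrC.
by rewrite (multint_unique leab majF Hh imz fu).
Qed.

(** With d a lower bound for the distance from the spectrum to [a, b], the cases are split by the
    distance of z to [a, b]. Beyond d / 2 Gronwall's bound applies; within d / 2 both z and its
    conjugate are at least d / 2 away from the spectrum, and the transfer formula applies. *)
Lemma transformed_bounded (Dz : set R[i]) :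
  (forall z, Dz z -> complex.Im z != 0) ->
  mx_bounded_on Dz (multint J H a b) -> mx_bounded_on Dz (multint J Ht a b).
Proof.
move=> imz [c Wc].
have [F [h [majF Hh]]] := mx_integrable_majorant H_int.
have h0 x : 0 <= h x by apply: le_trans (Hh x); exact: nm_ge0.
have [M M0 HM] := nm_bounded (ac_derive_darboux dA dD dPi' dGa dS' S_unit id_a' mQ0).1.
have HtM x : x \in `[a, b] -> nm (Ht x) <= M * M * h x.
  move=> xab; rewrite mulrAC; apply: nmM_le; last exact: HM.
  by apply: nmM_le; rewrite ?nm_adj ?HM.
have [s [sE sC]] := resolvent_bounded_off_spectrum B.
have [|d d0 ds] := @dist_segment_gt0 _ a b s.
  by move=> mu; rewrite sE => emu t tab; apply: contraTneq emu => ->; exact: B_spec.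
have d20 : 0 < d / 2 by rewrite divr_gt0.
have [CR CR0 HR] := sC _ d20.
have [CG HG] := fundamental_bounded J leab majF h0 (mulr_ge0 (ltW M0) (ltW M0)) HtM d20.
(* [q] bounds the multipliers at z and at its conjugate; through it [K1] bounds w(b,z) and [K2]
   bounds w(a,z)^-1. [CW] then bounds the transfer formula factor by factor. *)
pose q x := nm (Q0 x) + CR * nm (Q0 x) * nm (Q0 x).
pose K1 := nm (1%:M : 'M[R[i]]_m) + nm (Ga b) * nm (invmx (S b)) * q b * nm (Pi b).
pose K2 := nm (1%:M : 'M[R[i]]_m) + nm (Ga a) * q a * nm (invmx (S a)) * nm (Pi a).
pose CW := nm (invmx (w_ Q0 b)) * K1 * ((m * m)%:R * c) * (K2 * nm (w_ Q0 a)).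
exists (`|CG| + `|CW|) => z Dzz.
have [[wt fwt ->]|->] := multint_spec J a b Ht z; last first.
  by rewrite mx_norm0 ler0c addr_ge0.
apply: le_trans (mx_norm_le_nm _) _; rewrite lecR.
have [zfar|znear] := pselect (forall x : R, x \in `[a, b] -> d / 2 <= normc (z - x%:C)).
  by apply: le_trans (HG z wt zfar fwt) _; rewrite ler_wpDr // ler_norm.
have {znear}[x [xab zx]] : exists x : R, x \in `[a, b] /\ normc (z - x%:C) < d / 2.
  apply: contrapT => no; apply: znear => x xab; rewrite leNgt; apply/negP => lt.
  by apply: no; exists x.
have far z' : normc (z' - x%:C) < d / 2 ->
    forall mu, mu \in s -> d / 2 <= normc (z' - mu).
  move=> z'x mu mus; have := ds mu mus x xab.
  have : normc (mu - x%:C) <= normc (z' - mu) + normc (z' - x%:C).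
    rewrite (_ : mu - _ = - (z' - mu) + (z' - x%:C)); last by ring.
    by apply: le_trans (normcD _ _) _; rewrite (@normcN _ (z' - mu)).
  lra.
(* As x is real, the conjugate of z is equally close to it; the multiplier there enters
   w(a,z)^-1. *)
have zxc : normc (Num.conj z - x%:C) < d / 2.
  by rewrite -(conj_real x) -rmorphB normc_conj.
have good z' : normc (z' - x%:C) < d / 2 -> z'%:M - B \in unitmx /\
    forall y, nm (resolvent_multiplier B z' y) <= q y.
  move=> z'x.
  have uz : z'%:M - B \in unitmx.
    rewrite -opprB unitmxN unitmx_eigenvalue -sE; apply/negP => /(far z' z'x).
    by rewrite subrr ComplexField.Normc.normc0 leNgt d20.
  split=> // y; rewrite resolvent_multiplierE //; apply: nmD_le => //.
  by do 2 apply: nmM_le => //; apply: HR; exact: far.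
have [uz qz] := good _ zx; have [uzc qzc] := good _ zxc.
have ain : a \in `[a, b] by rewrite in_itv /= lexx.
have zx0 (y : R) : y \in `[a, b] -> z - y%:C != 0.
  move=> _; apply/eqP => /(congr1 (@complex.Im R)).
  by rewrite ImD /= oppr0 addr0; apply/eqP; exact: imz.
have mQ := multiplier_resolvent B_spec uz uzc zx0.
rewrite (transformed_multint (imz z Dzz) uz uzc fwt).
apply: (@le_trans _ _ CW); last by rewrite ler_wpDl // ler_norm.
apply: nmM_le; first apply: nmM_le; first apply: nmM_le => //.
- apply: nmD_le => //; rewrite nmN.
  by do 3 apply: nmM_le => //.
- by apply: nm_le_mx_norm; exact: Wc.
- apply: nmM_le => //.
  rewrite (invmx_darboux dA dD dPi' dGa dS' S_unit id_a' mQ ain).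
  apply: nmD_le => //; do 3 apply: nmM_le => //.
  by rewrite nm_adj.
Qed.
End TransformedSystem.

Lemma hermsymmxP (R : realType) m (M : 'M[R[i]]_m) : M \is hermsymmx -> M = M^t*.
Proof. by move/is_hermitianmxP; rewrite expr0 scale1r. Qed.

Theorem proposition3p4 (R : realType) (m n : nat) (m_gt0 : (0 < m)%N)
    (n_gt0 : (0 < n)%N) (a b : R) (leab : a <= b)
    (J : 'M[R[i]]_m) (J_herm : J = J^t*) (J_unit : J \in unitmx)
    (J_inv : J = invmx J)
    (H : R -> 'M[R[i]]_m) (H_int : mx_integrable a b H)
    (H_ge0 : {ae lebesgue_measure, forall x : R, x \in `[a, b] -> psdmx (H x)})
    (B : 'M[R[i]]_n)
    (B_spec : forall x : R, x \in `[a, b] -> ~~ eigenvalue B x%:C)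
    (Pi : R -> 'M[R[i]]_(n, m)) (S : R -> 'M[R[i]]_n) :
  let A x := invmx (B - x%:C%:M) in
  S a = (S a)^t* ->
  A a *m S a - S a *m (A a)^t* = 'i *: (Pi a *m J *m (Pi a)^t*) ->
  ac_derive a b Pi (fun x => - 'i *: (A x *m Pi x *m J *m H x)) ->
  ac_derive a b S (fun x =>
    Pi x *m J *m H x *m J^t* *m (Pi x)^t* -
    (A x *m S x + S x *m (A x)^t*)) ->
  (forall x : R, x \in `[a, b] -> S x \in unitmx) ->
  let w0 x :=
    1%:M - 'i *: (J *m (Pi x)^t* *m invmx (S x) *m invmx (A x) *m Pi x) in
  let Ht x := (w0 x)^t* *m H x *m w0 x in
  let W := multint J H a b in
  let Wt := multint J Ht a b in
  (mx_bounded_on (upper_half_plane R) W ->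
   mx_bounded_on (upper_half_plane R) Wt) /\
  (mx_bounded_on (lower_half_plane R) W ->
   mx_bounded_on (lower_half_plane R) Wt).
Proof.
move=> A Sa ida dPi dS SU w0 Ht W Wt.
have JJ : J *m J = 1%:M by rewrite {2}J_inv mulmxV.
have H_herm : {ae lebesgue_measure, forall x : R, x \in `[a, b] -> H x = (H x)^t*}.
  by apply: ae_imply H_ge0 => x Hx /Hx [/hermsymmxP].
(* [invmx (A x)] is B - x, the multiplier for l = 0. *)
have w0E : w0 = darboux S Pi (fun x => 'i *: (J *m (Pi x)^t*))
    (fun x : R => B - x%:C%:M).
  by apply/funext => x; rewrite /w0 /darboux /A invmxK -!scalemxAl.
have WtE : Wt = multint J (fun x => (darboux S Pi (fun x => 'i *: (J *m (Pi x)^t*))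
    (fun x : R => B - x%:C%:M) x)^t* *m H x *m darboux S Pi
    (fun x => 'i *: (J *m (Pi x)^t*)) (fun x : R => B - x%:C%:M) x) a b.
  by rewrite /Wt /Ht w0E.
rewrite WtE; split; apply: (transformed_bounded leab J_herm JJ H_int H_herm B_spec
  Sa ida dPi dS SU) => z /=.
  by move=> z0; rewrite gt_eqF.
by move=> z0; rewrite lt_eqF.
Qed.
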